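(* Let $G$ be a locally compact étale and Hausdorff groupoid. Let $c\in Z^1(G,\mathbf{R})$ be a continuous real-valued one-cocycle and let $\alpha$ denote the associated action of $\mathbf{R}$ on $C^*(G)$. Assume that $c^{-1}(0)$ is principal. Let $\beta \in \mathbf{R}$. Then every KMS state for $\alpha$ at inverse temperature $\beta$ is of the form $\omega_\mu$ for some quasi-invariant probability measure $\mu$ on $G^{(0)}$ with Radon-Nikodym derivative $dr^*\mu/ds^*\mu=e^{-\beta c}$.
   Context: $G^{(0)}$ is the unit space of $G$ and $r,s:G\to G^{(0)}$ are the range and source maps. $C^*(G)$ is the full groupoid C*-algebra of $G$ (a completion of the convolution algebra $C_c(G)$). $Z^1(G,\mathbf{R})$ is the set of continuous homomorphisms (one-cocycles) $c:G\to\mathbf{R}$. The action associated to $c$ is $\alpha:\mathbf{R}\to\mathrm{Aut}(C^*(G))$ given by $(\alpha_t(f))(\gamma)=e^{itc(\gamma)}f(\gamma)$ for $f\in C_c(G)$, $\gamma\in G$, $t\in\mathbf{R}$. ''$c^{-1}(0)$ is principal'' means that every $\gamma\in G$ with $r(\gamma)=s(\gamma)$ and $c(\gamma)=0$ is a unit. For a (Radon) probability measure $\mu$ on $G^{(0)}$, $r^*\mu$ and $s^*\mu$ are the measures on $G$ defined by $\int f\,d(r^*\mu)=\int_{G^{(0)}}\sum_{r(\gamma)=x}f(\gamma)\,d\mu(x)$ and $\int f\,d(s^*\mu)=\int_{G^{(0)}}\sum_{s(\gamma)=x}f(\gamma)\,d\mu(x)$ for $f\in C_c(G)$; $\mu$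 is quasi-invariant if $r^*\mu$ and $s^*\mu$ are equivalent. For a quasi-invariant probability measure $\mu$ with $dr^*\mu/ds^*\mu=e^{-\beta c}$, $\omega_\mu$ denotes the state of $C^*(G)$ determined by $\omega_\mu(f)=\int_{G^{(0)}}f(x)\,d\mu(x)$ for $f\in C_c(G)$. A state $\omega$ on a C*-algebra $A$ with a strongly continuous action $\alpha$ of $\mathbf{R}$ is a KMS state for $\alpha$ at inverse temperature $\beta\in\mathbf{R}$ if $\omega(b\,\alpha_{i\beta}(a))=\omega(ab)$ for all $a,b\in A$ with $a$ entire for $\alpha$.
   Formalization: For β = 0 a KMS state is additionally required to be α-invariant; without this the claim fails for G = Z, c(n) = n, where every state of the commutative algebra C*(Z) satisfies the KMS condition at β = 0 but only the one given by Haar measure is of the form ω_μ. *)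

(* Defs.v *)
From HB Require Import structures.
From mathcomp Require Export all_boot all_order all_algebra.
From mathcomp.real_closed Require Export complex.
From mathcomp Require Export all_classical all_reals all_analysis.

Set Implicit Arguments.
Unset Strict Implicit.
Unset Printing Implicit Defensive.

Import Order.TTheory GRing.Theory Num.Theory.
Import numFieldNormedType.Exports.

Local Open Scope classical_set_scope.
Local Open Scope ring_scope.

(* MathComp-Analysis attaches its topology to an element of numClosedFieldType,
   not to the bare type R[i]; Cx R is R[i] seen as such an element. *)
Definition Cx (R : realType) : numClosedFieldType := (R[i])%C.

Definition toCx (R : realType) (x y : R) : Cx R := (x +i* y)%C.

Definition expi (R : realType) (x : R) : Cx R := toCx (cos x) (sin x).

(* The product [mul g h] is meaningful only when [src g = rng h]; its values on
   other pairs are arbitrary.  The unit space is a separate space [unit_space],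
   identified with a subspace of the groupoid by [un] (a homeomorphism onto its
   image, with inverse induced by [rng]). Base points are there only because
   measurable types are pointed in the library. *)
Record topGroupoid := TopGroupoid {
  arr :> ptopologicalType;
  unit_space : ptopologicalType;
  rng : arr -> unit_space;
  src : arr -> unit_space;
  un : unit_space -> arr;
  mul : arr -> arr -> arr;
  inv : arr -> arr;
  rng_un : forall x, rng (un x) = x;
  src_un : forall x, src (un x) = x;
  rng_mul : forall g h, src g = rng h -> rng (mul g h) = rng g;
  src_mul : forall g h, src g = rng h -> src (mul g h) = src h;
  mulgA : forall g h k, src g = rng h -> src h = rng k ->
    mul g (mul h k) = mul (mul g h) k;
  mul_un_l : forall g, mul (un (rng g)) g = g;
  mul_un_r : forall g, mul g (un (src g)) = g;
  rng_inv : forall g, rng (inv g) = src g;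
  src_inv : forall g, src (inv g) = rng g;
  mul_inv_r : forall g, mul g (inv g) = un (rng g);
  mul_inv_l : forall g, mul (inv g) g = un (src g);
  rng_continuous : continuous rng;
  src_continuous : continuous src;
  un_continuous : continuous un;
  inv_continuous : continuous inv;
  mul_continuous : {within [set p : arr * arr | src p.1 = rng p.2],
    continuous (fun p : arr * arr => mul p.1 p.2)}
}.

Definition local_homeomorphism (X Y : topologicalType) (f : X -> Y) :=
  continuous f /\
  forall x, exists U : set X, [/\ open U, U x, set_inj U f &
    forall V : set X, open V -> V `<=` U -> open (f @` V)].

(* The source map is then a local homeomorphism too, being [rng \o inv]. *)
Definition etale (G : topGroupoid) := local_homeomorphism (@rng G).

Definition cocycle (R : realType) (G : topGroupoid) (c : G -> R) :=
  continuous c /\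
  forall g h : G, src g = rng h -> c (mul g h) = c g + c h.

Definition zero_set_principal (R : realType) (G : topGroupoid) (c : G -> R) :=
  forall g : G, rng g = src g -> c g = 0 -> exists x, g = un x.

Definition Cc (R : realType) (X : topologicalType) (f : X -> Cx R) :=
  continuous f /\ compact (closure [set x | f x != 0]).

(* The sum has finite support for f, f' in Cc and G etale. *)
Definition conv (R : realType) (G : topGroupoid) (f f' : G -> Cx R) : G -> Cx R :=
  fun g => \sum_(h \in [set h : G | rng h = rng g]) (f h * f' (mul (inv h) g)).

Definition invol (R : realType) (G : topGroupoid) (f : G -> Cx R) : G -> Cx R :=
  fun g => Num.conj (f (inv g)).

(* Not necessarily unital, hence not based on the (unital) ring structures. *)
Record cstarAlg (R : realType) := CstarAlg {
  cstar_space :> completeNormedModType (Cx R);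
  cmul : cstar_space -> cstar_space -> cstar_space;
  cstar : cstar_space -> cstar_space;
  cmulA : forall a b d, cmul a (cmul b d) = cmul (cmul a b) d;
  cmul_linear_l : forall (k : Cx R) a b d,
    cmul (k *: a + b) d = k *: cmul a d + cmul b d;
  cmul_linear_r : forall (k : Cx R) a b d,
    cmul d (k *: a + b) = k *: cmul d a + cmul d b;
  cstar_antilinear : forall (k : Cx R) a b,
    cstar (k *: a + b) = Num.conj k *: cstar a + cstar b;
  cstarK : forall a, cstar (cstar a) = a;
  cstarM : forall a b, cstar (cmul a b) = cmul (cstar b) (cstar a);
  cmul_norm : forall a b, `|cmul a b| <= `|a| * `|b|;
  cstar_identity : forall a, `|cmul (cstar a) a| = `|a| ^+ 2
}.

Record hilbertSpace (R : realType) := HilbertSpace {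
  hilbert_space :> completeNormedModType (Cx R);
  dotp : hilbert_space -> hilbert_space -> Cx R;
  dotp_linear_l : forall (k : Cx R) x y z,
    dotp (k *: x + y) z = k * dotp x z + dotp y z;
  dotp_conj : forall x y, dotp y x = Num.conj (dotp x y);
  dotp_norm : forall x, dotp x x = `|x| ^+ 2
}.

(* A representation of the *-algebra C_c(G) by bounded operators on H; the
   values of [p] outside C_c(G) are irrelevant. *)
Record representation (R : realType) (G : topGroupoid) (H : hilbertSpace R)
    (p : (G -> Cx R) -> H -> H) : Prop := {
  repr_linear : forall f, Cc f -> forall (k : Cx R) x y,
    p f (k *: x + y) = k *: p f x + p f y;
  repr_bounded : forall f, Cc f ->
    exists M : Cx R, 0 <= M /\ forall x, `|p f x| <= M * `|x|;
  repr_lin : forall (k : Cx R) f f', Cc f -> Cc f' -> forall x,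
    p (fun g => k * f g + f' g) x = k *: p f x + p f' x;
  repr_mul : forall f f', Cc f -> Cc f' -> forall x,
    p (conv f f') x = p f (p f' x);
  repr_star : forall f, Cc f -> forall x y,
    dotp (p f x) y = dotp x (p (invol f) y)
}.

(* [A] is the full C*-algebra of G, with canonical map [iota] : C_c(G) -> A:
   the completion of C_c(G) for the norm sup_p ||p f||, p ranging over all
   representations of C_c(G) on Hilbert spaces. The values of [iota] outside
   C_c(G) are irrelevant. *)
Record full_groupoid_algebra (R : realType) (G : topGroupoid) (A : cstarAlg R)
    (iota : (G -> Cx R) -> A) : Prop := {
  iota_linear : forall (k : Cx R) f f', Cc f -> Cc f' ->
    iota (fun g => k * f g + f' g) = k *: iota f + iota f';
  iota_mul : forall f f', Cc f -> Cc f' ->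
    iota (conv f f') = cmul (iota f) (iota f');
  iota_star : forall f, Cc f -> iota (invol f) = cstar (iota f);
  iota_norm_ub : forall f, Cc f ->
    forall (H : hilbertSpace R) (p : (G -> Cx R) -> H -> H),
    representation p -> forall x, `|p f x| <= `|iota f| * `|x|;
  iota_norm_lub : forall f, Cc f -> forall M : Cx R, 0 <= M ->
    (forall (H : hilbertSpace R) (p : (G -> Cx R) -> H -> H),
      representation p -> forall x, `|p f x| <= M * `|x|) ->
    `|iota f| <= M;
  iota_dense : closure (iota @` [set f | Cc f]) = setT
}.

Record cstar_action (R : realType) (A : cstarAlg R) (alpha : R -> A -> A)
    : Prop := {
  action_linear : forall t (k : Cx R) a b,
    alpha t (k *: a + b) = k *: alpha t a + alpha t b;
  action_mul : forall t a b, alpha t (cmul a b) = cmul (alpha t a) (alpha t b);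
  action_star : forall t a, alpha t (cstar a) = cstar (alpha t a);
  action0 : forall a, alpha 0 a = a;
  actionD : forall t u a, alpha (t + u) a = alpha t (alpha u a);
  action_continuous : forall a, continuous (fun t => alpha t a)
}.

Definition action_of_cocycle (R : realType) (G : topGroupoid) (A : cstarAlg R)
    (iota : (G -> Cx R) -> A) (c : G -> R) (alpha : R -> A -> A) :=
  cstar_action alpha /\
  forall t f, Cc f -> alpha t (iota f) = iota (fun g => expi (t * c g) * f g).

Definition state (R : realType) (A : cstarAlg R) (omega : {scalar A}) :=
  [/\ forall a : A, 0 <= omega (cmul (cstar a) a),
      forall a : A, `|omega a| <= `|a| &
      forall e : Cx R, 0 < e ->
        exists a : A, `|a| <= 1 /\ 1 - e < `|omega a|].

(* [a] is entire for alpha, and [F z] is alpha_z(a): derivability at z in the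
   direction 1 is complex differentiability. *)
Definition entire_extension (R : realType) (A : cstarAlg R) (alpha : R -> A -> A)
    (a : A) (F : Cx R -> A) :=
  (forall t : R, F (toCx t 0) = alpha t a) /\
  forall z : Cx R, derivable F z 1.

(* For beta <> 0 the KMS condition implies invariance under alpha. For
   beta = 0 it only says that omega is a trace, and invariance is required
   separately, as is customary: for G the group Z and c the inclusion Z -> R,
   every state of C^*(Z) = C(T) is a trace, but only Haar measure is of the
   form omega_mu. *)
Definition kms_state (R : realType) (A : cstarAlg R) (alpha : R -> A -> A)
    (beta : R) (omega : {scalar A}) :=
  [/\ state omega,
      forall (a b : A) (F : Cx R -> A), entire_extension alpha a F ->
        omega (cmul b (F (toCx 0 beta))) = omega (cmul a b) &
      beta = 0 -> forall t a, omega (alpha t a) = omega a].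

Definition borel (X : ptopologicalType) : Type := g_sigma_algebraType (@open X).
HB.instance Definition _ (X : ptopologicalType) :=
  Measurable.copy (borel X) (g_sigma_algebraType (@open X)).

Definition radon_measure (R : realType) (X : ptopologicalType)
    (mu : {measure set (borel X) -> \bar R}) :=
  [/\ forall K : set X, compact K -> (mu K < +oo)%E,
      forall E : set (borel X), measurable E ->
        mu E = ereal_inf [set mu U | U in [set U : set X | open U /\ E `<=` U]] &
      forall U : set X, open U ->
        mu U = ereal_sup [set mu K | K in [set K : set X | compact K /\ K `<=` U]]].

Definition cintegral (R : realType) (X : ptopologicalType)
    (mu : {measure set (borel X) -> \bar R}) (f : X -> Cx R) : Cx R :=
  toCx (Rintegral mu setT (fun x => complex.Re (f x)))
       (Rintegral mu setT (fun x => complex.Im (f x))).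

(* [nu] is p^* mu, for p the range or source map: the Radon measure given by
   f |-> int sum_(p g = x) f g dmu(x) on C_c(G). *)
Definition pullback_measure (R : realType) (G : topGroupoid)
    (p : G -> unit_space G) (mu : {measure set (borel (unit_space G)) -> \bar R})
    (nu : {measure set (borel G) -> \bar R}) :=
  radon_measure nu /\
  forall f : G -> Cx R, Cc f ->
    cintegral nu f = cintegral mu (fun x => \sum_(g \in [set g | p g = x]) f g).

Definition quasi_invariant (R : realType) (G : topGroupoid)
    (mu : {measure set (borel (unit_space G)) -> \bar R}) :=
  exists nur nus : {measure set (borel G) -> \bar R},
    [/\ pullback_measure (@rng G) mu nur, pullback_measure (@src G) mu nus,
        nur `<< nus & nus `<< nur].

(* d(r^* mu)/d(s^* mu) = h. These measures need not be sigma-finite, so the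
   library's Radon-Nikodym derivative does not apply. *)
Definition rn_derivative (R : realType) (G : topGroupoid)
    (mu : {measure set (borel (unit_space G)) -> \bar R}) (h : G -> R) :=
  exists nur nus : {measure set (borel G) -> \bar R},
    [/\ pullback_measure (@rng G) mu nur, pullback_measure (@src G) mu nus &
        forall E : set (borel G), measurable E ->
          nur E = (\int[nus]_(g in E) (h g)%:E)%E].

(* omega = omega_mu. *)
Definition is_omega (R : realType) (G : topGroupoid) (A : cstarAlg R)
    (iota : (G -> Cx R) -> A)
    (mu : {measure set (borel (unit_space G)) -> \bar R}) (omega : {scalar A}) :=
  state omega /\
  forall f, Cc f -> omega (iota f) = cintegral mu (fun x => f (un x)).

(* Main.v *)
From HB Require Import structures.
From mathcomp Require Import ring lra measurable_realfun.
From mathcomp Require finmap.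
Require Import Defs.
Import Order.TTheory GRing.Theory Num.Theory.
Import numFieldNormedType.Exports.

Set Implicit Arguments.
Unset Strict Implicit.
Unset Printing Implicit Defensive.

Local Open Scope classical_set_scope.
Local Open Scope ring_scope.

(** Write X for the unit space; a bisection is an open set of arrows on which rng and src are
    injective.

    The state omega is first confined to the units.  By a partition of unity it is enough to see
    that omega (iota f) = 0 when f is supported in a small neighbourhood of one arrow g that is not
    a unit.  If rng g <> src g, a bump function u on X that is 1 on the ranges and 0 on the sources
    of the support satisfies u * f = f and f * u = 0, and u is fixed by the dynamics because c
    vanishes on units; the KMS condition then gives omega (f) = omega (u * f) = omega (f * u) = 0.
    If rng g = src g, then c g <> 0 because the zero set of c is principal.  When beta <> 0, the KMS
    condition for f and a bump function that acts as a unit for f gives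
    omega (exp (- beta c) f) = omega (f) for all f in C_c(G), and dividing f by
    exp (- beta c) - 1, which has no zero near g, gives omega (f) = 0.  When beta = 0, invariance
    plays the same role with exp (i t c) for a suitable small t.  No boundedness argument for
    entire functions is involved: every f in C_c(G) is itself entire, with
    alpha_z (f) = exp (i z c) f ([iota_entire], [vanish_off_units], [omega_units]).

    Hence omega is determined by the functional u |-> omega (u) on C_c(X).  It is positive since
    u = k^* k with k the square root of u, so the Riesz representation theorem provides a Radon
    measure mu, and mu has mass 1 because omega has norm 1 ([riesz_complex], [total_mass]).

    For f and k supported in a bisection, f * k^* and k^* * f are functions on units, namely the
    sums of f conj(k) over the fibres of rng and of src.  Taking for k a bump function that is 1 on
    the support of f, the KMS condition becomes
    omega (sum of f over range fibres) = omega (sum of exp (- beta c) f over source fibres)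
    ([unit_functional_quasi_invariant]).  So r^* mu and s^* mu, again given by the Riesz theorem on
    G, are the measures of two functionals that differ by the continuous positive factor
    h = exp (- beta c), and such a relation passes from functionals to all Borel sets
    ([density_eq]) although neither measure need be sigma-finite.

    Two tools carry the rest.  [csupp_rect] is the partition of unity in the form of an induction
    principle on C_c.  [iota_mult_bound] bounds the C*-norm of phi f by a multiple of the supremum
    of phi over a compact set that depends on f only; it comes from representations of
    C_c(X) being contractive and is what makes z |-> exp (i z c) f differentiable. *)

(** * Continuous functions with compact support *)

Section continuity.
Context (K : numFieldType) (X : topologicalType).
Implicit Types f g : X -> K.

Lemma contD f g : continuous f -> continuous g -> continuous (fun x => f x + g x).
Proof. by move=> cf cg x; apply: (@continuousD K K X f g x); [exact: cf|exact: cg]. Qed.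

Lemma contM f g : continuous f -> continuous g -> continuous (fun x => f x * g x).
Proof. by move=> cf cg x; apply: (@continuousM K X f g x); [exact: cf|exact: cg]. Qed.

Lemma contN f : continuous f -> continuous (fun x => - f x).
Proof. by move=> cf x; apply: (@continuousN K K X f x); exact: cf. Qed.

Lemma contB f g : continuous f -> continuous g -> continuous (fun x => f x - g x).
Proof. by move=> cf cg; apply: contD => //; exact: contN. Qed.

Lemma contC (k : K) : continuous (fun _ : X => k).
Proof. exact: cst_continuous. Qed.

Lemma contZ k f : continuous f -> continuous (fun x => k * f x).
Proof. by move=> cf; apply: contM => //; exact: contC. Qed.

End continuity.

Lemma cont_min (R : realType) (X : topologicalType) (f g : X -> R) :
  continuous f -> continuous g -> continuous (fun t => Num.min (f t) (g t)).
Proof. by move=> cf cg t; apply: (@continuous_min R X f g); [exact: cf|exact: cg]. Qed.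

Lemma cont_max (R : realType) (X : topologicalType) (f g : X -> R) :
  continuous f -> continuous g -> continuous (fun t => Num.max (f t) (g t)).
Proof. by move=> cf cg t; apply: (@continuous_max R X f g); [exact: cf|exact: cg]. Qed.

Section urysohn.
Context (R : realType) (X : topologicalType).
Hypothesis X_lc : locally_compact [set: X].
Hypothesis X_hd : hausdorff_space X.

(** The one-point compactification is normal, so it carries a continuous f that is 0 on K and 1
    outside U, in particular at infinity.  Cutting 2 - 3 f off to [0, 1] leaves room on both sides:
    the result is 1 on a neighbourhood W of K and vanishes outside the compact set f <= 2/3. *)
Lemma lch_urysohn (K U : set X) : compact K -> open U -> K `<=` U ->
  exists (phi : X -> R) (C W : set X),
    [/\ continuous phi, (forall x, 0 <= phi x <= 1),
        [/\ compact C, C `<=` U & forall x, ~ C x -> phi x = 0] &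
        [/\ open W, K `<=` W & forall x, W x -> phi x = 1]].
Proof.
move=> cK oU KU; pose Y := @one_point_compactification X.
have hY : hausdorff_space Y by exact: one_point_compactification_hausdorff.
have clK : closed (Some @` K : set Y).
  apply: compact_closed => //; apply: continuous_compact => //.
  apply: continuous_subspaceT; exact: one_point_compactification_some_continuous.
have oSU : open (Some @` U : set Y) by exact: one_point_compactification_open_some.
have clU : closed (~` (Some @` U : set Y)) by exact: open_closedC.
have nY : normal_space Y.
  by apply: compact_normal => //; exact: one_point_compactification_compact.
have disj : (Some @` K : set Y) `&` ~` (Some @` U) = set0.
  by rewrite -subset0 => _ [[x Kx <-]] []; exists x => //; exact: KU.
have /(@normal_separatorP R Y)/(_ _ _ clK clU disj) := nY.
move=> /(@uniform_separatorP _ R)[f [cf f01 f0 f1]].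
pose g (x : X) := f (Some x).
have cg : continuous g.
  move=> x; apply: (@continuous_comp X Y R Some f); last exact: cf.
  exact: one_point_compactification_some_continuous.
have cfNone : nbhs (None : Y) (f @^-1` [set t | 2 / 3 < t]).
  apply: (cf (None : Y)); apply: open_nbhs_nbhs; split; first exact: open_gt.
  have -> : f None = 1 by apply: f1; exists None => // -[].
  by rewrite /=; lra.
pose C := [set x | g x <= 2 / 3].
have clC : closed C.
  by apply: (@preimage_closed X R g [set t | t <= 2 / 3]) => //; exact: closed_le.
have cC : compact C.
  case: cfNone => W [cW _] WC; apply: (subclosed_compact clC cW) => x Cx.
  apply: contrapT => nWx; have : 2 / 3 < f (Some x) by apply: WC; left; exists x.
  by move: Cx; rewrite /C /g /=; lra.
pose phi : X -> R := fun x => Num.max 0 (Num.min 1 (2 - 3 * g x)).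
exists phi, C, [set x | g x < 1 / 3]; split.
- apply: cont_max; first exact: contC; apply: cont_min; first exact: contC.
  by apply: contB; [exact: contC|exact: contZ].
- by move=> x; rewrite /phi le_max lexx /= ge_max ler01 ge_min lexx.
- split => //.
    move=> x Cx; apply: contrapT => nUx.
    have : g x = 1 by apply: f1; exists (Some x) => // -[y Uy [yx]]; rewrite yx in Uy.
    by move: Cx; rewrite /C /=; lra.
  move=> x; rewrite /C /= => /negP; rewrite -ltNge => gx.
  by rewrite /phi max_l // ge_min; apply/orP; right; lra.
- split.
  + by apply: (@open_comp X R g [set t | t < 1 / 3]) => [? _|]; [exact: cg|exact: open_lt].
  + by move=> x Kx; rewrite /= /g (f0 (f (Some x))); [lra|exists (Some x) => //; exists x].
  + by move=> x /= gx; rewrite /phi min_l ?max_r //; lra.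
Qed.

(** A partition of unity for two open sets: phi is supported in U, and on K the function 1 - phi
    is supported in V.  It is enough to make phi equal to 1 near the part of K that V misses. *)
Lemma lch_split (K U V : set X) : compact K -> open U -> open V ->
    K `<=` U `|` V ->
  exists (phi : X -> R) (C D : set X),
    [/\ continuous phi, (forall x, 0 <= phi x <= 1),
        [/\ compact C, C `<=` U & forall x, ~ C x -> phi x = 0] &
        [/\ compact D, D `<=` V & forall x, K x -> ~ D x -> phi x = 1]].
Proof.
move=> cK oU oV KUV.
have clK : closed K by exact: compact_closed.
have cKV : compact (K `&` ~` V).
  apply: (subclosed_compact _ cK); last by move=> x [].
  by apply: closedI => //; exact: open_closedC.
have KVU : K `&` ~` V `<=` U by move=> x [Kx nVx]; have [] := KUV _ Kx.
have [phi [C [W [cphi phi01 HC [oW KW phi1]]]]] := lch_urysohn cKV oU KVU.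
exists phi, C, (K `&` ~` W); split => //; split.
- apply: (subclosed_compact _ cK); last by move=> x [].
  by apply: closedI => //; exact: open_closedC.
- by move=> x [Kx nWx]; apply: contrapT => nVx; apply: nWx; apply: KW.
- by move=> x Kx nD; apply: phi1; apply: contrapT => nWx; apply: nD.
Qed.

End urysohn.

Lemma cont_comp (X Y Z : topologicalType) (f : X -> Y) (g : Y -> Z) :
  continuous f -> continuous g -> continuous (fun x => g (f x)).
Proof. by move=> cf cg x; apply: (@continuous_comp _ _ _ f g); [exact: cf|exact: cg]. Qed.

Lemma compact_image (X Y : topologicalType) (f : X -> Y) (C : set X) :
  continuous f -> compact C -> compact (f @` C).
Proof. by move=> cf cC; apply: continuous_compact => //; exact: continuous_subspaceT. Qed.

Lemma compact_bound (R : realType) (X : topologicalType) (C : set X) (f : X -> R) :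
  compact C -> continuous f -> exists2 M, 0 <= M & forall t, C t -> `|f t| <= M.
Proof.
move=> cC cf; have /compact_bounded [M [_ HM]] := compact_image cf cC.
exists (`|M| + 1); first by rewrite addr_ge0.
move=> t Ct; apply: HM; last by exists t.
by rewrite (le_lt_trans (ler_norm _)) // ltrDl.
Qed.

Definition csupp (K : numFieldType) (X : topologicalType) (U : set X) (f : X -> K) :=
  continuous f /\
  exists C : set X, [/\ compact C, C `<=` U & forall x, ~ C x -> f x = 0].

Section csupp.
Context (K : numFieldType) (X : topologicalType).
Implicit Types (f g : X -> K) (U : set X).

Lemma csupp_sub U V f : U `<=` V -> csupp U f -> csupp V f.
Proof.
by move=> UV [cf [C [cC CU f0]]]; split => //; exists C; split => // x /CU /UV.
Qed.

Lemma csupp0 U : csupp U (fun=> 0 : K).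
Proof.
split; first exact: contC.
by exists set0; split => //; exact: compact0.
Qed.

Lemma csuppD U f g : csupp U f -> csupp U g -> csupp U (fun x => f x + g x).
Proof.
move=> [cf [C [cC CU f0]]] [cg [D [cD DU g0]]]; split; first exact: contD.
exists (C `|` D); split; [exact: compactU|by move=> x [/CU|/DU]|].
by move=> x /not_orP [/f0 -> /g0 ->]; rewrite addr0.
Qed.

Lemma csuppMl U f g : continuous g -> csupp U f -> csupp U (fun x => g x * f x).
Proof.
move=> cg [cf [C [cC CU f0]]]; split; first exact: contM.
by exists C; split => // x /f0 ->; rewrite mulr0.
Qed.

Lemma csuppMr U f g : continuous g -> csupp U f -> csupp U (fun x => f x * g x).
Proof.
move=> cg cf; rewrite (_ : (fun x => _) = (fun x => g x * f x)); first exact: csuppMl.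
by apply/funext => x; rewrite mulrC.
Qed.

Lemma csuppZ U k f : csupp U f -> csupp U (fun x => k * f x).
Proof. by apply: csuppMl; exact: contC. Qed.

Lemma csuppB U f g : csupp U f -> csupp U g -> csupp U (fun x => f x - g x).
Proof.
move=> cf cg; rewrite (_ : (fun x => _) = (fun x => f x + (-1) * g x)).
  by apply: csuppD => //; exact: csuppZ.
by apply/funext => x; rewrite mulN1r.
Qed.

(** A function that vanishes outside a compact subset of V is continuous as soon as it is so at
    the points of V: at the other points it is locally zero. *)
Lemma csupp_open (U V : set X) f : hausdorff_space X -> open V -> V `<=` U ->
  (exists C, [/\ compact C, C `<=` V & forall x, ~ C x -> f x = 0]) ->
  (forall x, V x -> f @ x --> f x) -> csupp U f.
Proof.
move=> hX oV VU [C [cC CV f0]] cf; split; last by exists C; split => // x /CV /VU.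
move=> x; have [Vx|nVx] := pselect (V x); first exact: cf.
have nCx : ~ C x by move/CV.
rewrite /continuous_at (f0 _ nCx); apply: (@cvg_trans _ ((fun=> 0 : K) y @[y --> x])); last exact: cvg_cst.
apply: near_eq_cvg; have oC : open (~` C) by apply: closed_openC; exact: compact_closed.
have : nbhs x (~` C) by apply: open_nbhs_nbhs.
by apply: filterS => y nCy; rewrite f0.
Qed.

End csupp.

Lemma csupp_comp (K K' : numFieldType) (X : topologicalType) (U : set X)
    (f : X -> K) (phi : K -> K') :
  continuous phi -> phi 0 = 0 -> csupp U f -> csupp U (fun t => phi (f t)).
Proof.
move=> cphi phi0 [cf [C [cC CU f0]]]; split; first exact: (cont_comp cf cphi).
by exists C; split => // t /f0 ->.
Qed.

Lemma csupp_bounded (R : realType) (X : topologicalType) (f : X -> R) : csupp setT f ->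
  exists2 M, 0 <= M & forall t, `|f t| <= M.
Proof.
move=> [cf [C [cC _ f0]]]; have [M M0 HM] := compact_bound cC cf; exists M => // t.
by have [/HM//|/f0 ->] := pselect (C t); rewrite normr0.
Qed.

Lemma csupp_max0 (R : realType) (X : topologicalType) (U : set X) (f : X -> R) :
  csupp U f -> csupp U (fun t => Num.max (f t) 0).
Proof.
apply: (@csupp_comp R R X U f (fun x => Num.max x 0)); last exact: maxxx.
by apply: cont_max => [x|]; [exact: cvg_id|exact: contC].
Qed.

(** * Real coordinates of complex numbers *)

Section complex_numbers.
Context (R : realType).
Implicit Types (x y : R) (z w : Cx R).

Definition rc (x : R) : Cx R := toCx x 0.
Definition Rec (z : Cx R) : R := complex.Re z.
Definition Imc (z : Cx R) : R := complex.Im z.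
Definition ic : Cx R := toCx 0 1.
Definition nrm (z : Cx R) : R := Rec `|z|.

Lemma Cx_eqP z w : Rec z = Rec w -> Imc z = Imc w -> z = w.
Proof. by case: z w => [a b] [c d] /= -> ->. Qed.

Lemma RecD z w : Rec (z + w) = Rec z + Rec w. Proof. by case: z w => [a b] [c d]. Qed.
Lemma ImcD z w : Imc (z + w) = Imc z + Imc w. Proof. by case: z w => [a b] [c d]. Qed.
Lemma RecN z : Rec (- z) = - Rec z. Proof. by case: z => [a b]. Qed.
Lemma ImcN z : Imc (- z) = - Imc z. Proof. by case: z => [a b]. Qed.
Lemma RecM z w : Rec (z * w) = Rec z * Rec w - Imc z * Imc w.
Proof. by case: z w => [a b] [c d]. Qed.
Lemma ImcM z w : Imc (z * w) = Rec z * Imc w + Imc z * Rec w.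
Proof. by case: z w => [a b] [c d]. Qed.
Lemma Rec_toCx x y : Rec (toCx x y) = x. Proof. by []. Qed.
Lemma Imc_toCx x y : Imc (toCx x y) = y. Proof. by []. Qed.
Lemma Rec_rc x : Rec (rc x) = x. Proof. by []. Qed.
Lemma Imc_rc x : Imc (rc x) = 0. Proof. by []. Qed.
Lemma Rec0 : Rec 0 = 0. Proof. by []. Qed.
Lemma Imc0 : Imc 0 = 0. Proof. by []. Qed.
Lemma Rec1 : Rec 1 = 1. Proof. by []. Qed.
Lemma Imc1 : Imc 1 = 0. Proof. by []. Qed.
Lemma Rec_conj z : Rec (Num.conj z) = Rec z. Proof. by case: z => [a b]. Qed.
Lemma Imc_conj z : Imc (Num.conj z) = - Imc z. Proof. by case: z => [a b]. Qed.

Definition CxE := (RecD, ImcD, RecN, ImcN, RecM, ImcM, Rec_toCx, Imc_toCx,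
  Rec_rc, Imc_rc, Rec0, Imc0, Rec1, Imc1, Rec_conj, Imc_conj).

Lemma rc0 : rc 0 = 0. Proof. by []. Qed.
Lemma rc1 : rc 1 = 1. Proof. by []. Qed.
Lemma rcD x y : rc (x + y) = rc x + rc y. Proof. by apply: Cx_eqP; rewrite !CxE ?addr0. Qed.
Lemma rcN x : rc (- x) = - rc x. Proof. by apply: Cx_eqP; rewrite !CxE ?oppr0. Qed.
Lemma rcB x y : rc (x - y) = rc x - rc y. Proof. by rewrite rcD rcN. Qed.
Lemma rcM x y : rc (x * y) = rc x * rc y. Proof. by apply: Cx_eqP; rewrite !CxE; ring. Qed.
Lemma rcX x n : rc (x ^+ n) = rc x ^+ n.
Proof. by elim: n => // n IH; rewrite !exprS rcM IH. Qed.
Lemma rcV x : rc x^-1 = (rc x)^-1.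
Proof.
have [->|x0] := eqVneq x 0; first by rewrite invr0 rc0 invr0.
have rx0 : rc x != 0 by apply/eqP => /(congr1 Rec); rewrite /= => /eqP; rewrite (negPf x0).
by apply: (mulfI rx0); rewrite divff // -rcM divff.
Qed.

Lemma le_rc x y : (rc x <= rc y) = (x <= y).
Proof. exact: (@lecR R). Qed.
Lemma lt_rc x y : (rc x < rc y) = (x < y).
Proof. exact: (@ltcR R). Qed.
Lemma rc_ge0 x : (0 <= rc x) = (0 <= x).
Proof. by rewrite -rc0 le_rc. Qed.
Lemma rc_gt0 x : (0 < rc x) = (0 < x).
Proof. by rewrite -rc0 lt_rc. Qed.
Lemma rc_inj : injective rc. Proof. by move=> x y []. Qed.

Lemma le0_Cx z : (0 <= z) = (Imc z == 0) && (0 <= Rec z).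
Proof. exact: (@lecE R 0 z). Qed.

Lemma ge0_rc z : 0 <= z -> z = rc (Rec z).
Proof. by rewrite le0_Cx => /andP[/eqP Iz _]; apply: Cx_eqP. Qed.

Lemma ge0_Rec z : 0 <= z -> 0 <= Rec z.
Proof. by rewrite le0_Cx => /andP[]. Qed.

Lemma ge0_Imc z : 0 <= z -> Imc z = 0.
Proof. by rewrite le0_Cx => /andP[/eqP]. Qed.

Lemma rc_nrm z : `|z| = rc (nrm z).
Proof. exact: ge0_rc. Qed.

Lemma nrm_ge0 z : 0 <= nrm z. Proof. exact: ge0_Rec. Qed.

Lemma nrm_sqrt z : nrm z = Num.sqrt (Rec z ^+ 2 + Imc z ^+ 2).
Proof. by rewrite /nrm (@normc_def R z). Qed.

Lemma nrm_sq z : nrm z ^+ 2 = Rec z ^+ 2 + Imc z ^+ 2.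
Proof. by rewrite nrm_sqrt sqr_sqrtr // addr_ge0 ?sqr_ge0. Qed.

Lemma nrm_rc x : nrm (rc x) = `|x|.
Proof. by rewrite nrm_sqrt !CxE expr0n /= addr0 sqrtr_sqr. Qed.

Lemma norm_rc x : `|rc x| = rc `|x|.
Proof. by rewrite rc_nrm nrm_rc. Qed.

Lemma nrmM z w : nrm (z * w) = nrm z * nrm w.
Proof. by apply: rc_inj; rewrite rcM -!rc_nrm normrM. Qed.

Lemma nrmD z w : nrm (z + w) <= nrm z + nrm w.
Proof. by rewrite -le_rc rcD -!rc_nrm ler_normD. Qed.

Lemma nrm_Rec z : `|Rec z| <= nrm z.
Proof.
rewrite nrm_sqrt -sqrtr_sqr ler_sqrt ?addr_ge0 ?sqr_ge0 //.
by rewrite lerDl sqr_ge0.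
Qed.

Lemma nrm_Imc z : `|Imc z| <= nrm z.
Proof.
rewrite nrm_sqrt -sqrtr_sqr ler_sqrt ?addr_ge0 ?sqr_ge0 //.
by rewrite lerDr sqr_ge0.
Qed.

Lemma nrm_le z : nrm z <= `|Rec z| + `|Imc z|.
Proof.
rewrite nrm_sqrt -[leRHS]ger0_norm ?addr_ge0 // -sqrtr_sqr ler_sqrt ?sqr_ge0 //.
rewrite sqrrD !real_normK ?num_real //.
by rewrite lerD2r lerDl mulrn_wge0 // mulr_ge0.
Qed.

Lemma nrm_eq0 z : nrm z = 0 -> z = 0.
Proof. by move=> z0; apply/eqP; rewrite -normr_eq0 rc_nrm z0. Qed.

Lemma conjM_nrm z : Num.conj z * z = rc (nrm z ^+ 2).
Proof. by rewrite nrm_sq; apply: Cx_eqP; rewrite !CxE; ring. Qed.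

Lemma Cx_RecImc z : z = rc (Rec z) + ic * rc (Imc z).
Proof. by apply: Cx_eqP; rewrite !CxE; ring. Qed.

Lemma rc_continuous : continuous rc.
Proof.
move=> x; apply/cvgrPdist_lt => e e0.
have re0 : 0 < Rec e by rewrite -lt_rc -ge0_rc // ltW.
have H : \forall y \near x, `|x - y| < Rec e.
  exact: (@nbhsx_ballx R R^o x (Rec e) re0).
apply: filterS H => y xy.
by rewrite -rcB norm_rc (ge0_rc (ltW e0)) lt_rc.
Qed.

Lemma cont_lip (f : Cx R -> R) : (forall z w, f z - f w = f (z - w)) ->
  (forall z, `|f z| <= nrm z) -> continuous f.
Proof.
move=> fB fle z; apply/(@cvgrPdist_lt R R^o _ (nbhs z) (nbhs_filter z)) => e e0.
have H : \forall w \near z, `|z - w| < rc e.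
  by apply: (@nbhsx_ballx (Cx R) (Cx R) z (rc e)); rewrite rc_gt0.
apply: filterS H => w; rewrite rc_nrm lt_rc fB; exact: le_lt_trans.
Qed.

Lemma Rec_continuous : continuous Rec.
Proof. by apply: cont_lip; [move=> z w; rewrite !CxE|exact: nrm_Rec]. Qed.

Lemma Imc_continuous : continuous Imc.
Proof. by apply: cont_lip; [move=> z w; rewrite !CxE|exact: nrm_Imc]. Qed.

Lemma cont_cx (X : topologicalType) (f : X -> Cx R) :
  continuous (fun t : X => Rec (f t)) -> continuous (fun t : X => Imc (f t)) ->
  continuous f.
Proof.
move=> cR cI.
rewrite (_ : f = (fun t : X => rc (Rec (f t)) + ic * rc (Imc (f t)))); last first.
  by apply/funext => x; exact: Cx_RecImc.
by apply: contD; last apply: contZ; apply: cont_comp => //; exact: rc_continuous.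
Qed.

Lemma conj_continuous : continuous (Num.conj : Cx R -> Cx R).
Proof.
apply: cont_cx.
  rewrite (_ : (fun t : Cx R => _) = Rec); first exact: Rec_continuous.
  by apply/funext => z; rewrite Rec_conj.
rewrite (_ : (fun t : Cx R => _) = (fun t => - Imc t)); first exact/contN/Imc_continuous.
by apply/funext => z; rewrite Imc_conj.
Qed.

Lemma expi_continuous : continuous (@expi R).
Proof. by apply: cont_cx; [exact: continuous_cos|exact: continuous_sin]. Qed.

Lemma expiD x y : expi (x + y) = expi x * expi y.
Proof. by apply: Cx_eqP; rewrite !CxE /= ?cosD ?sinD //; ring. Qed.

End complex_numbers.

Section supports_complex.
Context (R : realType) (X : topologicalType) (U : set X).

Lemma csupp_rc (f : X -> R) : csupp U f -> csupp U (fun t => rc (f t)).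
Proof. by apply: csupp_comp; [exact: rc_continuous|]. Qed.

Lemma csupp_Rec (f : X -> Cx R) : csupp U f -> csupp U (fun t => Rec (f t)).
Proof. by apply: csupp_comp; [exact: Rec_continuous|]. Qed.

Lemma csupp_Imc (f : X -> Cx R) : csupp U f -> csupp U (fun t => Imc (f t)).
Proof. by apply: csupp_comp; [exact: Imc_continuous|]. Qed.

Lemma csupp_conj (f : X -> Cx R) : csupp U f -> csupp U (fun t => Num.conj (f t)).
Proof. by apply: csupp_comp; [exact: conj_continuous|exact: rmorph0]. Qed.

End supports_complex.

(** * Partitions of unity as an induction principle *)

Section supports.
Context (R : realType) (X : ptopologicalType).
Hypothesis X_lc : locally_compact [set: X].
Hypothesis X_hd : hausdorff_space X.
Implicit Types f g : X -> Cx R.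

Lemma Cc_csupp f : Cc f <-> csupp setT f.
Proof.
split=> [[cf cc]|[cf [C [cC _ f0]]]].
  split => //; exists (closure [set x | f x != 0]); split => //.
  move=> t; apply: contra_notP => /eqP ft; exact: subset_closure.
split => //; apply: (subclosed_compact _ cC); first exact: closed_closure.
have /closure_id -> : closed C by exact: compact_closed.
apply: closureS => t /eqP ft; apply: contrapT => /f0; exact: ft.
Qed.

(** Local-to-global principle for functions with compact support in U: a property stable under
    sums holds for all of them if it holds for those supported near each point of U.  Covering the
    support by finitely many of the given neighbourhoods, [lch_split] peels them off one by one. *)
Lemma csupp_rect (P : (X -> Cx R) -> Prop) (U : set X) :
  P (fun=> 0) ->
  (forall f g, csupp U f -> csupp U g -> P f -> P g -> P (fun t => f t + g t)) ->
  (forall t, U t -> exists V, [/\ open V, V t & forall f, csupp V f -> csupp U f -> P f]) ->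
  forall f, csupp U f -> P f.
Proof.
move=> P0 PD Ploc.
have /choice [V HV] : forall t, exists V, U t ->
    [/\ open V, V t & forall f, csupp V f -> csupp U f -> P f].
  move=> t.
  have [Ut|nUt] := pselect (U t); last by exists setT.
  by have [V HV] := Ploc _ Ut; exists V.
(* Induction on the list of base points of a finite cover of the support. *)
have Pseq (s : seq X) : (forall t, t \in s -> U t) ->
    forall f, csupp (\big[setU/set0]_(t <- s) V t) f -> csupp U f -> P f.
  elim: s => [|t s IH] sU f.
    rewrite big_nil => -[cf [C [_ C0 f0]]] _.
    rewrite (_ : f = (fun=> 0)) //; apply/funext => u; apply: f0.
    by move=> /C0.
  rewrite big_cons => -[cf [C [cC CV f0]]] cfU.
  have Ut : U t by apply: sU; rewrite mem_head.
  have [oV Vt PV] := HV _ Ut.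
  have sU' u : u \in s -> U u by move=> us; apply: sU; rewrite inE us orbT.
  have oVs : open (\big[setU/set0]_(u <- s) V u).
    rewrite big_seq; elim/big_ind : _ => //; first exact: open0.
      by move=> A B; exact: openU.
    by move=> u /sU' /HV[].
  have [phi [D [E [cphi phi01 [cD DV phi0] [cE EV phi1]]]]] :=
    @lch_split R X X_lc X_hd _ _ _ cC oV oVs CV.
  pose f1 u := rc (phi u) * f u.
  have cf1 : continuous (fun u => rc (phi u)).
    by apply: cont_comp => //; exact: rc_continuous.
  pose f2 u := rc (1 - phi u) * f u.
  have cf2 : continuous (fun u => rc (1 - phi u)).
    have c1 : continuous (fun u => 1 - phi u) by apply: contB => //; exact: contC.
    exact: (cont_comp c1 (@rc_continuous R)).
  rewrite (_ : f = (fun u => f1 u + f2 u)); last first.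
    by apply/funext => u; rewrite /f1 /f2 -mulrDl -rcD addrC subrK mul1r.
  have cs1 : csupp U f1 := csuppMl cf1 cfU.
  have cs2 : csupp U f2 := csuppMl cf2 cfU.
  apply: (PD f1 f2 cs1 cs2).
    apply: (PV f1 _ cs1); split; first exact: cs1.1.
    exists D; split; [exact: cD|exact: DV|].
    by move=> u /phi0 phu; rewrite /f1 phu mul0r.
  apply: (IH sU' f2 _ cs2); split; first exact: cs2.1.
  exists E; split; [exact: cE|exact: EV|] => u nEu; rewrite /f2.
  have [Cu|nCu] := pselect (C u); last by rewrite f0 // mulr0.
  by rewrite phi1 // subrr mul0r.
move=> f cfU; have [cf [C [cC CU f0]]] := cfU.
have : cover_compact C by rewrite -compact_cover.
move=> /(_ X C V)[t /CU /HV []// | t Ct| D DC CD].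
  by exists t => //; have [] := HV _ (CU _ Ct).
apply: (Pseq (finmap.enum_fset D) _ f _ cfU).
  by move=> t tD; apply: CU; apply: set_mem; exact: DC.
split; first exact: cf.
exists C; split; [exact: cC| |exact: f0] => t /CD [u uD Vtu].
by rewrite -bigcup_seq; exists u.
Qed.

End supports.

(** * The Radon measure of a positive functional *)

Section riesz_outer.
Context (R : realType) (X : ptopologicalType).
Hypothesis X_lc : locally_compact [set: X].
Hypothesis X_hd : hausdorff_space X.
Variable L : (X -> R) -> R.
Hypothesis LD : forall f g : X -> R, csupp setT f -> csupp setT g ->
  L (fun t => f t + g t) = L f + L g.
Hypothesis LZ : forall (k : R) (f : X -> R), csupp setT f ->
  L (fun t => k * f t) = k * L f.
Hypothesis L_ge0 : forall f : X -> R, csupp setT f -> (forall t, 0 <= f t) -> 0 <= L f.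

Lemma L_le (f g : X -> R) : csupp setT f -> csupp setT g ->
  (forall t, f t <= g t) -> L f <= L g.
Proof.
move=> cf cg fg; have cgf := csuppB cg cf.
rewrite (_ : g = (fun t => f t + (g t - f t))); last first.
  by apply/funext => t; rewrite addrC subrK.
by rewrite LD // lerDl; apply: L_ge0 => // t; rewrite subr_ge0.
Qed.

Lemma L_0 : L (fun=> 0) = 0.
Proof.
have := LZ 0 (@csupp0 R X setT); by rewrite mul0r => L00; rewrite L00 mul0r.
Qed.

Definition subordinate (U : set X) (f : X -> R) := csupp U f /\ forall t, 0 <= f t <= 1.

(** The measure of an open set U that the Riesz theorem prescribes. *)
Definition open_mass (U : set X) : \bar R := ereal_sup [set (L f)%:E | f in subordinate U].

Definition radon_outer (E : set X) : \bar R :=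
  ereal_inf [set open_mass U | U in [set U | open U /\ E `<=` U]].

Lemma subordinate_sub U V f : U `<=` V -> subordinate U f -> subordinate V f.
Proof. by move=> UV [cf f01]; split => //; exact: csupp_sub cf. Qed.

Lemma subordinate_open_mass U f : subordinate U f -> ((L f)%:E <= open_mass U)%E.
Proof. by move=> cf; apply: ereal_sup_ubound; exists f. Qed.

Lemma open_mass_ge0 U : (0 <= open_mass U)%E.
Proof.
apply: (@le_trans _ _ (L (fun=> 0))%:E); first by rewrite L_0.
apply: subordinate_open_mass; split; first exact: csupp0.
by move=> t; rewrite lexx ler01.
Qed.

Lemma open_mass_le U V : U `<=` V -> (open_mass U <= open_mass V)%E.
Proof.
move=> UV; apply: ereal_sup_le => _ [f cf <-]; exists f => //; exact: subordinate_sub cf.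
Qed.

Lemma open_mass0 : open_mass set0 = 0%E.
Proof.
apply/eqP; rewrite eq_le open_mass_ge0 andbT; apply: ge_ereal_sup => _ [f [[cf [C [_ C0 f0]]] _] <-].
rewrite (_ : f = (fun=> 0)) ?L_0 //; apply/funext => t; apply: f0; exact: C0.
Qed.

(** A function subordinate to a finite union splits, by [lch_split], into a sum of functions
    subordinate to its members. *)
Lemma open_mass_finite (U : nat -> set X) N f : (forall n, open (U n)) ->
  subordinate (\big[setU/set0]_(n < N) U n) f ->
  ((L f)%:E <= \sum_(n < N) open_mass (U n))%E.
Proof.
move=> oU; elim: N f => [|N IH] f.
  by rewrite !big_ord0 -open_mass0; exact: subordinate_open_mass.
rewrite !big_ord_recr /= => -[[cf [C [cC CU f0]]] f01].
have oUN : open (\big[setU/set0]_(n < N) U n) by elim/big_ind : _ => [|A B|i _]; [exact: open0|exact: openU|exact: oU].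
have [phi [D [E [cphi phi01 [cD DU phi0] [cE EU phi1]]]]] :=
  @lch_split R X X_lc X_hd _ _ _ cC oUN (oU N) CU.
pose f1 t := phi t * f t; pose f2 t := (1 - phi t) * f t.
have cf2 : continuous (fun t => 1 - phi t) by apply: contB => //; exact: contC.
have pf1 : subordinate (\big[setU/set0]_(n < N) U n) f1.
  split; last first.
    move=> t; rewrite /f1; have /andP[p0 p1] := phi01 t; have /andP[q0 q1] := f01 t.
    by rewrite mulr_ge0 // mulr_ile1.
  split; first exact: contM.
  by exists D; split => // t nDt; rewrite /f1 phi0 // mul0r.
have pf2 : subordinate (U N) f2.
  split; last first.
    move=> t; rewrite /f2; have /andP[p0 p1] := phi01 t; have /andP[q0 q1] := f01 t.
    by rewrite mulr_ge0 ?mulr_ile1 // ?subr_ge0 // gerBl.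
  split; first exact: contM.
  exists E; split => // t nEt; rewrite /f2.
  have [Ct|nCt] := pselect (C t); first by rewrite phi1 // subrr mul0r.
  by rewrite f0 // mulr0.
rewrite (_ : f = (fun t => f1 t + f2 t)); last first.
  by apply/funext => t; rewrite /f1 /f2 -mulrDl addrC subrK mul1r.
rewrite LD; [|exact: csupp_sub pf1.1|exact: csupp_sub pf2.1].
by rewrite EFinD leeD // ?IH // subordinate_open_mass.
Qed.

Lemma open_mass_bigcup (U : nat -> set X) : (forall n, open (U n)) ->
  (open_mass (\bigcup_n U n) <= \sum_(n <oo) open_mass (U n))%E.
Proof.
move=> oU; apply: ge_ereal_sup => _ [f [[cf [C [cC CU f0]]] f01] <-].
have : cover_compact C by rewrite -compact_cover.
move=> /(_ _ setT U)[t _ //| t /CU [n _ Unt]|D _ CD]; first by exists n.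
pose N := (\max_(i <- finmap.enum_fset D) i).+1.
apply: le_trans (@nneseries_lim_ge _ (fun n => open_mass (U n)) xpredT 0 N _); last first.
  by move=> n _ _; exact: open_mass_ge0.
rewrite big_mkord; apply: open_mass_finite => //; split => //; split => //.
exists C; split => // t /CD [n nD Unt]; rewrite -bigcup_mkord; exists n => //=.
by rewrite /N ltnS; apply: (@leq_bigmax_seq _ _ xpredT id).
Qed.

Lemma radon_outer_open U : open U -> radon_outer U = open_mass U.
Proof.
move=> oU; apply/eqP; rewrite eq_le; apply/andP; split.
  by apply: ereal_inf_lbound; exists U => //; split.
by apply: le_ereal_inf_tmp => _ [V [oV UV] <-]; exact: open_mass_le.
Qed.

Lemma radon_outer_ge0 E : (0 <= radon_outer E)%E.
Proof. by apply: le_ereal_inf_tmp => _ [V _ <-]; exact: open_mass_ge0. Qed.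

Lemma radon_outer0 : radon_outer set0 = 0%E.
Proof. by rewrite radon_outer_open ?open_mass0 //; exact: open0. Qed.

Lemma radon_outer_le E F : E `<=` F -> (radon_outer E <= radon_outer F)%E.
Proof.
move=> EF; apply: ereal_inf_le_tmp => _ [U [oU FU] <-]; exists U => //.
by split => //; exact: subset_trans FU.
Qed.

Lemma radon_outer_le_open E U : open U -> E `<=` U -> (radon_outer E <= open_mass U)%E.
Proof. by move=> oU EU; apply: ereal_inf_lbound; exists U. Qed.

Lemma radon_outer_adherent E (e : R) : 0 < e -> (radon_outer E < +oo)%E ->
  exists U, [/\ open U, E `<=` U & (open_mass U <= radon_outer E + e%:E)%E].
Proof.
move=> e0 Efin.
have Ef : radon_outer E \is a fin_num by rewrite ge0_fin_numE // radon_outer_ge0.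
have [_ [U [oU EU] <-] Ue] := lb_ereal_inf_adherent e0 Ef.
by exists U; split => //; exact: ltW.
Qed.

(** On open sets this is [open_mass_bigcup]; the general case follows by choosing for each set an
    open neighbourhood with an excess of e / 2^(n+1). *)
Lemma radon_outer_sigma_subadditive : sigma_subadditive radon_outer.
Proof.
move=> A; have [[i ioo]|] := pselect (exists i, radon_outer (A i) = +oo%E).
  rewrite (eseries_pinfty _ _ ioo) ?leey// => n _.
  by rewrite -ltNye (lt_le_trans _ (radon_outer_ge0 _)).
rewrite -forallNE => Aoo.
apply/lee_addgt0Pr => e e0.
apply: le_trans (epsilon_trick _ _ (ltW e0)); last by move=> n; exact: radon_outer_ge0.
have /choice [U HU] : forall n, exists U, [/\ open U, A n `<=` U &
    (open_mass U <= radon_outer (A n) + (e / (2 ^ n.+1)%:R)%:E)%E].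
  move=> n; apply: radon_outer_adherent; last by rewrite ltey; apply/eqP; exact: Aoo.
  by rewrite divr_gt0 // ltr0n expn_gt0.
apply: (@le_trans _ _ (open_mass (\bigcup_n U n))).
  apply: radon_outer_le_open; first by apply: bigcup_open => n _; have [] := HU n.
  by apply: subset_bigcup => n _; have [] := HU n.
apply: (le_trans (open_mass_bigcup _)); first by move=> n; have [] := HU n.
by apply: lee_nneseries => n *; [exact: open_mass_ge0|have [_ _] := HU n].
Qed.

Definition radon_outer_measure : {outer_measure set X -> \bar R} :=
  HB.pack radon_outer (@isOuterMeasure.Build R X radon_outer radon_outer0 radon_outer_ge0 radon_outer_le
    radon_outer_sigma_subadditive).

(** It suffices to test against an open W.  If f is subordinate to W and U and has support C,
    and g is subordinate to W minus C, then f + g is subordinate to W, so L f + L g <= open_mass W;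
    then take suprema over g and over f. *)
Lemma open_caratheodory U : open U -> (radon_outer_measure.-caratheodory U)%mu.
Proof.
move=> oU; apply: le_caratheodory_measurable => E /=.
change (radon_outer (E `&` U) + radon_outer (E `&` ~` U) <= radon_outer E)%E.
apply: le_ereal_inf_tmp => _ [W [oW EW] <-].
apply: (@le_trans _ _ (open_mass (W `&` U) + radon_outer (W `&` ~` U)))%E.
  apply: leeD.
    by apply: radon_outer_le_open; [exact: openI|exact: setSI].
  by apply: radon_outer_le; exact: setSI.
have [->|Wfin] := eqVneq (open_mass W) +oo%E; first by rewrite leey.
have WUle : (radon_outer (W `&` ~` U) <= open_mass W)%E.
  by apply: radon_outer_le_open => // x [].
have WUf : radon_outer (W `&` ~` U) \is a fin_num.
  by rewrite ge0_fin_numE ?radon_outer_ge0 //; apply: le_lt_trans WUle _; rewrite ltey.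
rewrite -leeBrDr //; apply: ge_ereal_sup => _ [f pf <-].
have [[cf [C [cC CWU f0]]] f01] := pf.
rewrite leeBrDr // addeC -leeBrDr //.
apply: (@le_trans _ _ (open_mass (W `&` ~` C))).
  apply: radon_outer_le_open.
    by apply: openI => //; apply: closed_openC; exact: compact_closed.
  by move=> x [Wx nUx]; split => // /CWU [].
apply: ge_ereal_sup => _ [g pg <-].
have [[cg [D [cD DWC g0]]] g01] := pg.
rewrite leeBrDr // -EFinD -LD; [|exact: csupp_sub pg.1|exact: csupp_sub pf.1].
apply: subordinate_open_mass; split.
  by apply: csuppD; [apply: csupp_sub pg.1 => x []|apply: csupp_sub pf.1 => x []].
move=> t; have [Ct|nCt] := pselect (C t).
  by rewrite g0 ?add0r // => /DWC [].
by rewrite f0 // addr0.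
Qed.

Lemma borel_caratheodory (E : set (borel X)) : measurable E ->
  (radon_outer_measure.-caratheodory E)%mu.
Proof.
move=> mE; suff : (<<s @open X >> `<=` radon_outer_measure.-caratheodory)%mu by exact.
apply: smallest_sub; last exact: open_caratheodory.
exact: (@sigma_algebra_measurable _ (caratheodory_type radon_outer_measure)).
Qed.

Lemma riesz_measure : exists nu : {measure set (borel X) -> \bar R},
  forall E, nu E = radon_outer E.
Proof.
pose m : set (borel X) -> \bar R := radon_outer.
have m0 : m set0 = 0%E by exact: radon_outer0.
have mge0 E : (0 <= m E)%E by exact: radon_outer_ge0.
have msa : semi_sigma_additive m.
  move=> A mA tA mU.
  have := @caratheodory_measure_sigma_additive R X radon_outer_measure A.
  apply => //; first by move=> n; exact: borel_caratheodory.
  exact: borel_caratheodory.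
pose nu : {measure set (borel X) -> \bar R} :=
  HB.pack m (isMeasure.Build _ _ _ m m0 mge0 msa).
by exists nu.
Qed.

(** Any open neighbourhood of C has f among its subordinate functions. *)
Lemma L_le_radon_outer (f : X -> R) (C : set X) : compact C -> continuous f ->
  (forall t, 0 <= f t <= 1) -> (forall t, ~ C t -> f t = 0) ->
  ((L f)%:E <= radon_outer C)%E.
Proof.
move=> cC cf f01 f0; apply: le_ereal_inf_tmp => _ [U [oU CU] <-].
by apply: subordinate_open_mass; split => //; split => //; exists C.
Qed.

(** For t < 1 the open set t < f contains K, and a function g subordinate to it satisfies
    t g <= f, whence t radon_outer K <= L f. *)
Lemma radon_outer_le_L (f : X -> R) (K : set X) : csupp setT f ->
  (forall t, 0 <= f t) -> (forall t, K t -> 1 <= f t) ->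
  (radon_outer K <= (L f)%:E)%E.
Proof.
move=> cf f0 f1.
have H t : 0 < t < 1 -> (radon_outer K <= (L f / t)%:E)%E.
  move=> /andP[t0 t1]; apply: (@le_trans _ _ (open_mass [set x | t < f x])).
    apply: radon_outer_le_open; last by move=> x /f1 /=; exact: lt_le_trans.
    by apply: (@open_comp X R f [set u | t < u]) => [? _|]; [exact: cf.1|exact: open_gt].
  apply: ge_ereal_sup => _ [g [cg g01] <-]; rewrite lee_fin ler_pdivlMr // mulrC.
  have cg' : csupp setT g by exact: csupp_sub cg.
  rewrite -LZ //; apply: L_le => //; first exact: csuppZ.
  move=> x; have /andP[g0 g1] := g01 x.
  have [tf|ft] := ltP t (f x); first by rewrite (le_trans _ (ltW tf)) // ger_pMr.
  have [_ [C [_ CV gC]]] := cg.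
  by rewrite gC ?mulr0 // => /CV /=; rewrite ltNge ft.
have L0 : 0 <= L f by exact: L_ge0.
have Kf : radon_outer K \is a fin_num.
  rewrite ge0_fin_numE ?radon_outer_ge0 //; apply: le_lt_trans (H 2^-1 _) _; last by rewrite ltey.
  by lra.
rewrite -(fineK Kf) lee_fin; set r := fine _.
have {}H t : 0 < t < 1 -> r * t <= L f.
  move=> t01; have /andP[t0 _] := t01.
  by have := H _ t01; rewrite -(fineK Kf) lee_fin ler_pdivlMr.
rewrite leNgt; apply/negP => Lr.
have r0 : 0 < r by exact: le_lt_trans Lr.
have := H ((L f / r + 1) / 2); have : L f / r < 1 by rewrite ltr_pdivrMr // mul1r.
have : 0 <= L f / r by rewrite divr_ge0 // ltW.
have : r * (L f / r) = L f by rewrite mulrC divfK // gt_eqF.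
(* The value t = (L f / r + 1) / 2 lies in ]0, 1[ and has r t > L f. *)
set q := L f / r => rq q0 q1; move=> /(_ ltac:(lra)); nra.
Qed.

Lemma radon_outer_compact K : compact K -> (radon_outer K < +oo)%E.
Proof.
move=> cK; have [phi [C [W [cphi phi01 [cC _ phi0] [_ KW phi1]]]]] :=
  @lch_urysohn R X X_lc X_hd K setT cK openT (fun _ _ => I).
apply: (@le_lt_trans _ _ (L phi)%:E); last by rewrite ltey.
apply: radon_outer_le_L.
- by split => //; exists C.
- by move=> t; have /andP[] := phi01 t.
- by move=> t /KW /phi1 ->.
Qed.

Lemma open_mass_inner U : open U ->
  open_mass U = ereal_sup [set radon_outer K | K in [set K | compact K /\ K `<=` U]].
Proof.
move=> oU; apply/eqP; rewrite eq_le; apply/andP; split; last first.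
  by apply: ge_ereal_sup => _ [K [cK KU] <-]; exact: radon_outer_le_open.
apply: ge_ereal_sup => _ [f [[cf [C [cC CU f0]]] f01] <-].
apply: (le_trans (L_le_radon_outer cC cf f01 f0)).
by apply: ereal_sup_ubound; exists C.
Qed.

End riesz_outer.

(** * The Riesz representation theorem *)

(** The two bounds that any integral I satisfies on indicator-like functions, relative to the
    measure v of compact sets.  They determine I on C_c ([layer_le]), so it suffices to check them
    for the functional and for integration against its measure. *)
Definition integral_like (R : realType) (X : topologicalType)
    (v : set X -> R) (I : (X -> R) -> R) :=
  [/\ (forall f g : X -> R, csupp setT f -> csupp setT g ->
         I (fun t => f t + g t) = I f + I g),
      (forall (k : R) (f : X -> R), csupp setT f -> I (fun t => k * f t) = k * I f),
      (forall (f : X -> R) C, compact C -> csupp setT f ->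
         (forall t, 0 <= f t <= 1) -> (forall t, ~ C t -> f t = 0) -> I f <= v C) &
      (forall (f : X -> R) K, compact K -> csupp setT f ->
         (forall t, 0 <= f t <= 1) -> (forall t, K t -> f t = 1) -> v K <= I f)].

Definition level_set (R : realType) (X : Type) (f : X -> R) (C : set X) (e : R) (j : nat) :=
  [set t | C t /\ j%:R * e <= f t].

Section layer_cake.
Context (R : realType) (X : topologicalType) (v : set X -> R).

(** Layer-cake decomposition: the truncation of f at height N e is a sum of N layers of
    thickness e, and the layer number j is e times a function with values in [0, 1] which is 1 on
    the level set j+1 and vanishes off the level set j. *)
Lemma layer_bracket (I : (X -> R) -> R) (f : X -> R) (C : set X) (e : R) N :
  integral_like v I -> continuous f -> compact C ->
  (forall t, ~ C t -> f t = 0) -> (forall t, 0 <= f t) -> 0 < e ->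
  e * \sum_(j < N) v (level_set f C e j.+1) <=
    I (fun t => Num.min (f t) (N%:R * e)) <=
    e * \sum_(j < N) v (level_set f C e j).
Proof.
move=> cI cf cC f0 fge0 e0; set K := level_set f C e; have [ID IZ Iup Ilo] := cI.
have cK j : compact (K j).
  have -> : K j = C `&` [set t | j%:R * e <= f t] by [].
  apply: compact_closedI => //.
  by apply: (@preimage_closed X R f [set u | j%:R * e <= u]) => [? _|]; [exact: cf|exact: closed_ge].
pose T j t := Num.min (f t) (j%:R * e).
have csT j : csupp setT (T j).
  split; first by apply: cont_min => //; exact: contC.
  by exists C; split => // t /f0; rewrite /T => ->; rewrite min_l // mulr_ge0 // ltW.
elim: N => [|N IH].
  rewrite !big_ord0 mulr0 (_ : (fun t => _) = (fun t => 0 * f t)).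
    by rewrite IZ ?mul0r ?lexx //; split => //; exists C.
  by apply/funext => t; rewrite !mul0r min_r.
(* The layer number N, normalized to have values in [0, 1]. *)
pose d t := e^-1 * (T N.+1 t - T N t).
have csd : csupp setT d by apply: csuppZ; exact: csuppB.
have dE t : T N.+1 t - T N t = e * d t.
  by rewrite /d mulrA divff ?mul1r // gt_eqF.
have NSe : N.+1%:R * e = N%:R * e + e by rewrite -natr1 mulrDl mul1r.
have d01 t : 0 <= d t <= 1.
  have H : 0 <= e * d t <= e * 1.
    rewrite -dE mulr1 /T NSe.
    by case: (leP (f t) (N%:R * e)); case: (leP (f t) (N%:R * e + e)); lra.
  by move: H => /andP[]; rewrite pmulr_rge0 // ler_pM2l // => -> ->.
have -> : (fun t => Num.min (f t) (N.+1%:R * e)) = (fun t => T N t + e * d t).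
  by apply/funext => t; rewrite -dE addrC subrK.
rewrite (ID _ _ (csT N) (csuppZ e csd)) (IZ _ _ csd).
rewrite !big_ord_recr /= !mulrDr.
have /andP[IH1 IH2] := IH.
apply/andP; split; apply: lerD => //; rewrite ler_pM2l //.
  apply: (Ilo d _ (cK N.+1) csd d01) => t [Ct ft].
  apply: (@mulfI _ e); first by rewrite gt_eqF.
  move: ft; rewrite -dE mulr1 /T NSe => ft; rewrite !min_r //; lra.
apply: (Iup d _ (cK N) csd d01) => t nK; rewrite /d /T.
have [Ct|/f0 ->] := pselect (C t); last first.
  by rewrite !min_l ?subrr ?mulr0 // mulr_ge0 // ltW.
have ft : f t < N%:R * e by rewrite ltNge; apply/negP => ?; apply: nK.
by rewrite !min_l ?subrr ?mulr0 // ?NSe; lra.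
Qed.

(** The lower and upper sums of [layer_bracket] differ by a telescoping sum, at most e v C. *)
Lemma layer_le (I J : (X -> R) -> R) (f : X -> R) :
  integral_like v I -> integral_like v J -> csupp setT f -> (forall t, 0 <= f t) ->
  I f <= J f.
Proof.
move=> cI cJ csf fge0; have [cf [C [cC _ f0]]] := csf.
have [M M0 HM] := csupp_bounded csf.
have [_ _ Iup Ilo] := cI.
have vge0 A : compact A -> 0 <= v A.
  move=> cA; have [_ IZ _ _] := cI.
  have I0 : I (fun t => 0 * f t) = 0 by rewrite IZ // mul0r.
  rewrite -I0; apply: Iup => //.
  - exact: csuppZ.
  - by move=> t; rewrite mul0r lexx ler01.
  - by move=> t _; rewrite mul0r.
apply/ler_addgt0Pr => d d0.
pose e := d / (v C + 1).
have e0 : 0 < e by rewrite divr_gt0 // ltr_wpDl // vge0.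
have [N MN] : exists N, M <= N%:R * e.
  exists (Num.bound (M / e)).
  by rewrite -ler_pdivrMr //; apply: ltW; apply: archi_boundP; rewrite divr_ge0 // ltW.
have fmin : (fun t => Num.min (f t) (N%:R * e)) = f.
  apply/funext => t; rewrite min_l //; apply: le_trans MN.
  exact: le_trans (ler_norm _) (HM t).
have /andP[_ I2] := layer_bracket N cI cf cC f0 fge0 e0.
have /andP[J1 _] := layer_bracket N cJ cf cC f0 fge0 e0.
move: I2 J1; rewrite fmin; set K := level_set f C e => I2 J1.
(* Lower and upper sums are shifts of each other. *)
have tel : \sum_(j < N) v (K j) + v (K N) = v (K 0) + \sum_(j < N) v (K j.+1).
  by transitivity (\sum_(j < N.+1) v (K j)); [rewrite big_ord_recr|rewrite big_ord_recl].
have K0 : K 0 = C.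
  by apply/seteqP; split => [t []//|t Ct]; split => //; rewrite mul0r.
have cKN : compact (K N).
  have -> : K N = C `&` [set t | N%:R * e <= f t] by [].
  apply: compact_closedI => //.
  by apply: (@preimage_closed X R f [set u | N%:R * e <= u]) => [? _|]; [exact: cf|exact: closed_ge].
have vKN := vge0 _ cKN; have vC := vge0 _ cC.
have : e * (\sum_(j < N) v (K j) + v (K N)) = e * v C + e * \sum_(j < N) v (K j.+1).
  by rewrite tel K0 mulrDr.
have ev : e * v C <= d.
  rewrite /e mulrAC ler_pdivrMr ?ltr_wpDl // ler_pM2l //; lra.
have : 0 <= e * v (K N) by rewrite mulr_ge0 // ltW.
rewrite mulrDr; lra.
Qed.

End layer_cake.

Section borel.
Context (R : realType) (X : ptopologicalType).
Hypothesis X_hd : hausdorff_space X.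

Lemma borel_open (U : set X) : open U -> measurable (U : set (borel X)).
Proof. exact: sub_sigma_algebra. Qed.

Lemma borel_closed (U : set X) : closed U -> measurable (U : set (borel X)).
Proof.
by move=> cU; rewrite -(setCK U); apply: measurableC; apply: borel_open; exact: closed_openC.
Qed.

Lemma borel_compact (U : set X) : compact U -> measurable (U : set (borel X)).
Proof. by move=> cU; apply: borel_closed; exact: compact_closed. Qed.

Lemma borel_continuous (f : X -> R) : continuous f ->
  measurable_fun setT (f : borel X -> R).
Proof.
move=> /continuousP cf; apply: (measurability _ (RGenOpens.measurableE R)).
move=> _ [_ [a [b ->] <-]]; rewrite setTI; apply: borel_open.
exact/cf/interval_open.
Qed.

Variable nu : {measure set (borel X) -> \bar R}.
Hypothesis nu_fin : forall K : set X, compact K -> (nu K < +oo)%E.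

Lemma csupp_restrict (f : X -> R) (C : set X) : (forall t, ~ C t -> f t = 0) -> f \_ C = f.
Proof.
move=> f0; apply/funext => t; rewrite patchE; case: ifPn => // /negP tC.
by rewrite f0 // => Ct; apply: tC; rewrite inE.
Qed.

Lemma csupp_integrable (f : X -> R) : csupp setT f ->
  nu.-integrable setT (EFin \o (f : borel X -> R)).
Proof.
move=> csf; have [cf [C [cC _ f0]]] := csf.
have [M M0 HM] := csupp_bounded csf.
have mC := borel_compact cC.
have : nu.-integrable C (EFin \o (f : borel X -> R)).
  apply: measurable_bounded_integrable => //; first exact: nu_fin.
    by apply: measurable_funTS; exact: borel_continuous.
  exists M; split; first exact: num_real.
  by move=> x Mx t _ /=; apply: le_trans (HM t) (ltW Mx).
move/(integrable_mkcond _ mC).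
rewrite (_ : ((EFin \o _) \_ _) = EFin \o (f : borel X -> R)) //.
apply/funext => t; rewrite patchE /=; case: ifPn => // /negP tC.
by rewrite f0 // => Ct; apply: tC; rewrite inE.
Qed.

Lemma Rintegral_integral_like : integral_like (fun K => fine (nu K))
  (fun f => Rintegral nu setT (f : borel X -> R)).
Proof.
split.
- by move=> f g csf csg; rewrite RintegralD //; exact: csupp_integrable.
- by move=> k f csf; rewrite RintegralZl //; exact: csupp_integrable.
- move=> f C cC csf f01 f0; have mC := borel_compact cC.
  rewrite -(csupp_restrict f0) -Rintegral_mkcond.
  apply: (@le_trans _ _ (\int[nu]_(x in C) 1)); last by rewrite Rintegral_cst // mul1r.
  apply: le_Rintegral => //.
  + by apply: (integrableS _ _ _ (csupp_integrable csf)).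
  + apply: measurable_bounded_integrable => //; first exact: nu_fin.
    exists 1; split; first exact: num_real.
    by move=> x x1 t _ /=; rewrite normr1 ltW.
  + by move=> t _; have /andP[] := f01 t.
- move=> f K cK csf f01 f1; have mK := borel_compact cK.
  have -> : fine (nu K) = \int[nu]_(x in K) f x.
    rewrite (@eq_Rintegral _ _ _ nu K (fun=> 1)); last by move=> t; rewrite inE => /f1.
    by rewrite Rintegral_cst // mul1r.
  rewrite Rintegral_mkcond; apply: le_Rintegral => //.
  + have /(integrable_mkcond _ mK) : nu.-integrable K (EFin \o (f : borel X -> R)).
      by apply: (integrableS _ _ _ (csupp_integrable csf)).
    congr (nu.-integrable _ _); apply/funext => t; rewrite /= !patchE.
    by case: ifP.
  + exact: csupp_integrable.
  + by move=> t _; rewrite patchE; case: ifP => // _; have /andP[] := f01 t.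
Qed.

End borel.

Section riesz.
Context (R : realType) (X : ptopologicalType).
Hypothesis X_lc : locally_compact [set: X].
Hypothesis X_hd : hausdorff_space X.

(** Both L and integration against the measure given by [radon_outer] satisfy [integral_like], so
    they agree on nonnegative functions. *)
Lemma riesz_real (L : (X -> R) -> R) :
  (forall f g : X -> R, csupp setT f -> csupp setT g ->
    L (fun t => f t + g t) = L f + L g) ->
  (forall (k : R) (f : X -> R), csupp setT f -> L (fun t => k * f t) = k * L f) ->
  (forall f : X -> R, csupp setT f -> (forall t, 0 <= f t) -> 0 <= L f) ->
  exists nu : {measure set (borel X) -> \bar R},
    [/\ radon_measure nu,
        (forall f : X -> R, csupp setT f -> Rintegral nu setT (f : borel X -> R) = L f) &
        forall U, open U -> nu U = open_mass L U].
Proof.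
move=> LD LZ Lge0; have [nu nuE] := riesz_measure X_lc X_hd LD LZ.
have nuO U : open U -> nu U = open_mass L U by move=> oU; rewrite nuE radon_outer_open.
have nufin K : compact K -> (nu K < +oo)%E.
  by move=> cK; rewrite nuE; exact: radon_outer_compact.
exists nu; split=> //.
  split => //.
    move=> E _; rewrite nuE; congr ereal_inf; apply/seteqP; split => _ [U [oU EU] <-];
      by exists U => //; rewrite nuO.
  move=> U oU; rewrite nuO // open_mass_inner //; congr ereal_sup.
  by apply/seteqP; split => _ [K HK <-]; exists K => //; rewrite nuE.
have cakeL : integral_like (fun K => fine (nu K)) L.
  split => //.
    move=> f C cC csf f01 f0; rewrite -lee_fin fineK; last first.
      by rewrite ge0_fin_numE // nufin.
    by rewrite nuE; apply: L_le_radon_outer => //; exact: csf.1.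
  move=> f K cK csf f01 f1; rewrite -lee_fin fineK; last first.
    by rewrite ge0_fin_numE // nufin.
  rewrite nuE; apply: radon_outer_le_L => //.
    by move=> t; have /andP[] := f01 t.
  by move=> t /f1 ->.
have cakeN := Rintegral_integral_like X_hd nufin.
have pos f : csupp setT f -> (forall t, 0 <= f t) ->
    Rintegral nu setT (f : borel X -> R) = L f.
  move=> csf f0; apply/eqP; rewrite eq_le; apply/andP; split.
    exact: (layer_le cakeN cakeL).
  exact: (layer_le cakeL cakeN).
have [ND NZ _ _] := cakeN.
move=> f csf; pose f1 t := Num.max (f t) 0; pose f2 t := Num.max (- f t) 0.
have cs1 : csupp setT f1 by exact: csupp_max0.
have cs2 : csupp setT f2.
  by apply: csupp_max0; apply: csupp_comp csf => [t|]; [exact: opp_continuous|exact: oppr0].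
have -> : f = (fun t => f1 t + (-1) * f2 t).
  apply/funext => t; rewrite /f1 /f2 mulN1r.
  by case: (leP (f t) 0) => ft; [rewrite max_l|rewrite max_r]; lra.
rewrite ND //; last exact: csuppZ.
rewrite NZ // LD //; last exact: csuppZ.
by rewrite LZ // !pos // => t; rewrite le_max lexx orbT.
Qed.

Definition re_functional (T : (X -> Cx R) -> Cx R) (f : X -> R) : R := Rec (T (fun t => rc (f t))).

Lemma re_functionalD (T : (X -> Cx R) -> Cx R) :
  (forall f g : X -> Cx R, csupp setT f -> csupp setT g ->
    T (fun t => f t + g t) = T f + T g) ->
  forall f g : X -> R, csupp setT f -> csupp setT g ->
    re_functional T (fun t => f t + g t) = re_functional T f + re_functional T g.
Proof.
move=> TD f g cf cg; rewrite /re_functional -RecD -TD; [|exact: csupp_rc|exact: csupp_rc].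
by congr (Rec (T _)); apply/funext => t; rewrite rcD.
Qed.

Lemma re_functionalZ (T : (X -> Cx R) -> Cx R) :
  (forall (k : Cx R) (f : X -> Cx R), csupp setT f -> T (fun t => k * f t) = k * T f) ->
  forall (k : R) (f : X -> R), csupp setT f ->
    re_functional T (fun t => k * f t) = k * re_functional T f.
Proof.
move=> TZ k f cf; rewrite /re_functional.
have -> : (fun t => rc (k * f t)) = (fun t => rc k * rc (f t)).
  by apply/funext => t; rewrite rcM.
by rewrite TZ ?CxE ?mul0r ?subr0 //; exact: csupp_rc.
Qed.

Lemma re_functional_ge0 (T : (X -> Cx R) -> Cx R) :
  (forall f : X -> Cx R, csupp setT f -> (forall t, 0 <= f t) -> 0 <= T f) ->
  forall f : X -> R, csupp setT f -> (forall t, 0 <= f t) -> 0 <= re_functional T f.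
Proof.
move=> Tge0 f cf f0; apply: ge0_Rec; apply: Tge0; first exact: csupp_rc.
by move=> t; rewrite rc_ge0.
Qed.

(** A positive functional is real on real functions, as it is so on the positive and negative
    parts; it is then given by its values on real functions, to which [riesz_real] applies. *)
Lemma riesz_complex (T : (X -> Cx R) -> Cx R) :
  (forall f g : X -> Cx R, csupp setT f -> csupp setT g ->
    T (fun t => f t + g t) = T f + T g) ->
  (forall (k : Cx R) (f : X -> Cx R), csupp setT f -> T (fun t => k * f t) = k * T f) ->
  (forall f : X -> Cx R, csupp setT f -> (forall t, 0 <= f t) -> 0 <= T f) ->
  exists nu : {measure set (borel X) -> \bar R},
    [/\ radon_measure nu,
        (forall f : X -> Cx R, csupp setT f -> cintegral nu f = T f) &
        forall U, open U -> nu U = open_mass (re_functional T) U].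
Proof.
move=> TD TZ Tge0.
have [nu [rnu nuL nuU]] := riesz_real (re_functionalD TD) (re_functionalZ TZ) (re_functional_ge0 Tge0).
exists nu; split => // f csf; rewrite /cintegral.
have real g : csupp setT g -> T (fun t => rc (g t)) = rc (re_functional T g).
  move=> csg; pose f1 t := Num.max (g t) 0; pose f2 t := Num.max (- g t) 0.
  have cs1 : csupp setT f1 by exact: csupp_max0.
  have cs2 : csupp setT f2.
    by apply: csupp_max0; apply: csupp_comp csg => [t|]; [exact: opp_continuous|exact: oppr0].
  apply: Cx_eqP => //; rewrite Imc_rc.
  have -> : (fun t => rc (g t)) = (fun t => rc (f1 t) + (-1) * rc (f2 t)).
    apply/funext => t; rewrite /f1 /f2 mulN1r -rcB; congr rc.
    by case: (leP (g t) 0) => ft; [rewrite max_l|rewrite max_r]; lra.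
  rewrite TD; [|exact: csupp_rc|by apply: csuppZ; exact: csupp_rc].
  rewrite TZ; last exact: csupp_rc.
  rewrite mulN1r ImcD ImcN !ge0_Imc ?oppr0 ?addr0 //; apply: Tge0; try exact: csupp_rc.
    by move=> t; rewrite rc_ge0 le_max lexx orbT.
  by move=> t; rewrite rc_ge0 le_max lexx orbT.
have csR := csupp_Rec csf; have csI := csupp_Imc csf.
rewrite (nuL _ csR) (nuL _ csI).
have -> : T f = T (fun t => rc (Rec (f t)) + ic R * rc (Imc (f t))).
  by congr T; apply/funext => t; exact: Cx_RecImc.
rewrite TD; [|exact: csupp_rc|by apply: csuppZ; exact: csupp_rc].
rewrite TZ; last exact: csupp_rc.
by rewrite !real //; apply: Cx_eqP; rewrite !CxE; ring.
Qed.

End riesz.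

(** * Radon measures with a continuous density *)

Lemma lee_of_mul_gt1 (R : realType) (x y : \bar R) :
  (0 <= y)%E -> (forall q : R, 1 < q -> (x <= q%:E * y)%E) -> (x <= y)%E.
Proof.
move=> y0 H; have [->|yfin] := eqVneq y +oo%E; first by rewrite leey.
have yf : y \is a fin_num by rewrite ge0_fin_numE // ltey.
have fy0 : 0 <= fine y by exact: fine_ge0.
apply/lee_addgt0Pr => e e0.
have d0 : 0 < e / (fine y + 1) by rewrite divr_gt0 // ltr_wpDl.
apply: (le_trans (H (1 + e / (fine y + 1)) _)); first by rewrite ltrDl.
rewrite -[in leLHS](fineK yf) -[in leRHS](fineK yf) -EFinM -EFinD lee_fin mulrDl mul1r lerD2l.
by rewrite mulrAC ler_pdivrMr ?ltr_wpDl // ler_pM2l // lerDl ler01.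
Qed.

Section density.
Context (R : realType) (X : ptopologicalType).
Variables (m n : {measure set (borel X) -> \bar R}) (h : X -> R).
Hypothesis h_cont : continuous h.
Hypothesis h_gt0 : forall t, 0 < h t.
Hypothesis m_outer : forall E : set (borel X), measurable E ->
  m E = ereal_inf [set m U | U in [set U : set X | open U /\ E `<=` U]].
Hypothesis n_outer : forall E : set (borel X), measurable E ->
  n E = ereal_inf [set n U | U in [set U : set X | open U /\ E `<=` U]].
Hypothesis mn_bounds_open : forall (U : set X) (a b : R), open U -> 0 < a -> 0 < b ->
  (forall t, U t -> a <= h t <= b) -> (a%:E * n U <= m U <= b%:E * n U)%E.

Let W (a q : R) : set X := [set t | a < h t < q * a].

Let W_open a q : open (W a q).
Proof.
have -> : W a q = h @^-1` (`]a, q * a[%classic).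
  by apply/seteqP; split => t; rewrite /W /= in_itv.
by apply: open_comp => [? _|]; [exact: h_cont|exact: interval_open].
Qed.

(** Outer regularity passes the bounds from open sets to Borel sets: the neighbourhoods of E may be
    cut down to W. *)
Let mn_bounds_borel (E : set (borel X)) (a q : R) : 0 < a -> 1 < q ->
  measurable E -> E `<=` W a q ->
  (a%:E * n E <= m E <= (q * a)%:E * n E)%E.
Proof.
move=> a0 q1 mE EW.
have qa0 : 0 < q * a by rewrite mulr_gt0 // (lt_trans ltr01).
have HU U : open U -> (a%:E * n (U `&` W a q) <= m (U `&` W a q) <= (q * a)%:E * n (U `&` W a q))%E.
  move=> oU; apply: mn_bounds_open => //; first exact: openI.
  by move=> t [_ /andP[h1 h2]]; rewrite !ltW.
have mW : measurable (W a q : set (borel X)) by exact: borel_open.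
apply/andP; split.
  rewrite [leRHS]m_outer //; apply: le_ereal_inf_tmp => _ [U [oU EU] <-].
  have /andP[H _] := HU _ oU.
  have mU : measurable (U : set (borel X)) by exact: borel_open.
  apply: (@le_trans _ _ (a%:E * n (U `&` W a q)))%E.
    apply: lee_wpmul2l; first by rewrite lee_fin ltW.
    by apply: le_measure; rewrite ?inE //; [exact: measurableI|move=> t Et; split; [exact: EU|exact: EW]].
  apply: (le_trans H); apply: le_measure; rewrite ?inE //; first exact: measurableI.
rewrite [n E]n_outer // -ereal_inf_pZl //; apply: le_ereal_inf_tmp => _ [_ [U [oU EU] <-] <-].
have /andP[_ H] := HU _ oU.
have mU : measurable (U : set (borel X)) by exact: borel_open.
apply: (@le_trans _ _ (m (U `&` W a q))).
  by apply: le_measure; rewrite ?inE //; [exact: measurableI|move=> t Et; split; [exact: EU|exact: EW]].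
apply: (le_trans H); apply: lee_wpmul2l; first by rewrite lee_fin ltW.
by apply: le_measure; rewrite ?inE //; exact: measurableI.
Qed.

Let h_measurable (E : set (borel X)) : measurable E -> measurable_fun E (fun g : borel X => (h g)%:E).
Proof.
move=> mE; apply/measurable_EFinP; apply: measurable_funTS; exact: borel_continuous.
Qed.

Let n_integral_bounds (E : set (borel X)) (a q : R) : 0 < a -> 1 < q ->
  measurable E -> E `<=` W a q ->
  (a%:E * n E <= \int[n]_(g in E) (h g)%:E <= (q * a)%:E * n E)%E.
Proof.
move=> a0 q1 mE EW; rewrite -!integral_cst //; apply/andP; split; apply: ge0_le_integral => //=.
- by move=> t _; rewrite lee_fin ltW.
- exact: h_measurable.
- by move=> t /EW /andP[? _]; rewrite lee_fin ltW.
- by move=> t _; rewrite lee_fin ltW.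
- exact: h_measurable.
- by move=> t /EW /andP[_ ?]; rewrite lee_fin ltW.
Qed.

Let multiplicative_cover (q : R) : 1 < q -> exists a : nat -> R, (forall k, 0 < a k) /\
  \bigcup_k W (a k) q = setT.
Proof.
move=> q1.
pose a (k : nat) : R := let x := ratr (odflt 1 (unpickle k : option rat)) in if 0 < x then x else 1.
exists a; split; first by move=> k; rewrite /a; case: ifP.
apply/seteqP; split => // t _.
have q0 : 0 < q by exact: lt_trans q1.
have ht := h_gt0 t.
have : h t / q < h t by rewrite ltr_pdivrMr // ltr_pMr.
move=> /rat_in_itvoo [r]; rewrite in_itv /= => /andP[r1 r2].
have r0 : 0 < ratr r :> R by apply: lt_trans r1; rewrite divr_gt0.
have ar : a (pickle r) = ratr r.
  by rewrite /a pickleK; change (odflt 1 (Some r)) with r; rewrite r0.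
exists (pickle r); first exact: I.
apply/andP; rewrite ar; split; first exact: r2.
by move: r1; rewrite ltr_pdivrMr // mulrC.
Qed.

Let pieces (q : R) (E : set (borel X)) : 1 < q -> measurable E ->
  exists (a : nat -> R) (F : nat -> set (borel X)),
    [/\ forall k, 0 < a k, forall k, measurable (F k), trivIset setT F,
        E = \bigcup_k F k & forall k, F k `<=` W (a k) q].
Proof.
move=> q1 mE; have [a [a0 aT]] := multiplicative_cover q1.
pose Wn k : set (borel X) := W (a k) q.
have mW k : measurable (Wn k) by apply: borel_open; exact: W_open.
exists a, (fun k => E `&` seqDU Wn k); split => //.
- by move=> k; apply: measurableI => //; exact: seqDU_measurable.
- exact/trivIset_setIl/trivIset_seqDU.
- by rewrite -setI_bigcupr -seqDU_bigcup_eq aT setIT.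
- by move=> k t [_ kt]; exact: (subset_seqDU kt).
Qed.

(** The line is cut multiplicatively: X is covered by countably many open sets on which
    a < h < q a.  On Borel subsets of such a set, m and the integral of h against n both lie between
    a n and q a n, so they agree up to the factor q. *)
Lemma density_le (q : R) (E : set (borel X)) : 1 < q -> measurable E ->
  (m E <= q%:E * \int[n]_(g in E) (h g)%:E)%E /\
  (\int[n]_(g in E) (h g)%:E <= q%:E * m E)%E.
Proof.
move=> q1 mE; have q0 : 0 < q by exact: lt_trans q1.
have [a [F [a0 mF tF EF FW]]] := pieces q1 mE.
have int0 k : (0 <= \int[n]_(g in F k) (h g)%:E)%E.
  by apply: integral_ge0 => t _; rewrite lee_fin ltW.
have mU : measurable (\bigcup_k F k) by rewrite -EF.
have eqm : m E = (\sum_(k <oo) m (F k))%E.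
  rewrite EF measure_bigcup //.
  by apply: eq_eseriesl => k; exact: mem_set.
have eqi : (\int[n]_(g in E) (h g)%:E = \sum_(k <oo) \int[n]_(g in F k) (h g)%:E)%E.
  rewrite EF ge0_integral_bigcup //; first exact: h_measurable.
  by move=> t _; rewrite lee_fin ltW.
rewrite eqm eqi -!nneseriesZl //.
have mul k : ((q * a k)%:E * n (F k) = q%:E * ((a k)%:E * n (F k)))%E.
  by rewrite EFinM muleA.
split; apply: lee_nneseries => //= k _.
  have /andP[_ H1] := mn_bounds_borel (a0 k) q1 (mF k) (FW k).
  have /andP[H2 _] := n_integral_bounds (a0 k) q1 (mF k) (FW k).
  by apply: (le_trans H1); rewrite mul; apply: lee_wpmul2l => //; rewrite lee_fin ltW.
have /andP[H1 _] := mn_bounds_borel (a0 k) q1 (mF k) (FW k).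
have /andP[_ H2] := n_integral_bounds (a0 k) q1 (mF k) (FW k).
by apply: (le_trans H2); rewrite mul; apply: lee_wpmul2l => //; rewrite lee_fin ltW.
Qed.

(** Let q tend to 1 in [density_le]; a multiplicative error is what allows sets of infinite
    measure. *)
Lemma density_eq (E : set (borel X)) : measurable E ->
  m E = (\int[n]_(g in E) (h g)%:E)%E.
Proof.
move=> mE; apply/eqP; rewrite eq_le; apply/andP; split; apply: lee_of_mul_gt1.
- by apply: integral_ge0 => t _; rewrite lee_fin ltW.
- by move=> q q1; have [] := density_le q1 mE.
- exact: measure_ge0.
- by move=> q q1; have [] := density_le q1 mE.
Qed.

Lemma density_equivalent : m `<< n /\ n `<< m.
Proof.
have q1 : (1 : R) < 2 by rewrite ltr1n.
have H (E : set (borel X)) : measurable E -> (m E = 0 <-> n E = 0)%E.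
  move=> mE; have [a [F [a0 mF tF EF FW]]] := pieces q1 mE.
  have Fz (p : {measure set (borel X) -> \bar R}) : (p E = 0 <-> forall k, p (F k) = 0)%E.
    split=> [p0 k|p0].
      apply/eqP; rewrite eq_le measure_ge0 andbT -p0.
      by apply: le_measure; rewrite ?inE // EF; exact: bigcup_sup.
    by rewrite EF measure_bigcup // eseries0.
  split=> /Fz H0; apply/Fz => k.
    have /andP[H1 _] := mn_bounds_borel (a0 k) q1 (mF k) (FW k).
    move: H1; rewrite H0 => H1; apply/eqP; rewrite eq_le measure_ge0 andbT.
    by move: H1; rewrite muleC pmule_lle0 // lte_fin.
  have /andP[_ H1] := mn_bounds_borel (a0 k) q1 (mF k) (FW k).
  by move: H1; rewrite H0 mule0 => H1; apply/eqP; rewrite eq_le measure_ge0 andbT.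
by split; apply/null_content_dominatesP => E mE /H; apply.
Qed.

End density.

Section open_mass_density.
Context (R : realType) (X : ptopologicalType).
Variables (L M : (X -> R) -> R) (h : X -> R).
Hypothesis LD : forall f g : X -> R, csupp setT f -> csupp setT g ->
  L (fun t => f t + g t) = L f + L g.
Hypothesis LZ : forall (k : R) (f : X -> R), csupp setT f ->
  L (fun t => k * f t) = k * L f.
Hypothesis L_ge0 : forall f : X -> R, csupp setT f -> (forall t, 0 <= f t) -> 0 <= L f.
Hypothesis h_cont : continuous h.
Hypothesis ML : forall f : X -> R, csupp setT f -> M f = L (fun t => h t * f t).

(** If M f = L (h f), then a L <= M <= b L on the nonnegative functions supported where
    a <= h <= b. *)
Lemma open_mass_density (U : set X) (a b : R) : 0 < a -> 0 < b ->
  (forall t, U t -> a <= h t <= b) ->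
  (a%:E * open_mass L U <= open_mass M U <= b%:E * open_mass L U)%E.
Proof.
move=> a0 b0 hab.
have H f : subordinate U f -> a * L f <= M f <= b * L f.
  move=> [csf f01].
  have csf' : csupp setT f by exact: csupp_sub csf.
  have [_ [C [_ CU f0]]] := csf.
  rewrite ML // -!LZ //.
  have D t : a * f t <= h t * f t <= b * f t.
    have [Ut|nUt] := pselect (U t); last by rewrite f0 ?mulr0 ?lexx // => /CU.
    have /andP[f0t _] := f01 t; have /andP[ah hb] := hab t Ut.
    by rewrite !ler_wpM2r.
  apply/andP; split; apply: L_le => //; try exact: csuppZ; try exact: csuppMl.
    by move=> t; have /andP[] := D t.
  by move=> t; have /andP[] := D t.
apply/andP; split.
  rewrite -ereal_sup_pZl //; apply: ge_ereal_sup => _ [_ [f pf <-] <-].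
  apply: (@le_trans _ _ (M f)%:E); last exact: subordinate_open_mass.
  by rewrite -EFinM lee_fin; have /andP[] := H f pf.
apply: ge_ereal_sup => _ [f pf <-].
apply: (@le_trans _ _ (b%:E * (L f)%:E)%E).
  by rewrite -EFinM lee_fin; have /andP[] := H f pf.
by apply: lee_wpmul2l; [rewrite lee_fin ltW|exact: subordinate_open_mass].
Qed.

End open_mass_density.

(** * Sums over the fibres of a local homeomorphism *)

Definition fiber_sum (R : realType) (X Y : ptopologicalType) (p : X -> Y) (f : X -> Cx R)
    (y : Y) : Cx R :=
  \sum_(g \in [set g | p g = y]) f g.

Section fiber_sum.
Context (R : realType) (X Y : ptopologicalType) (p : X -> Y).
Hypothesis X_lc : locally_compact [set: X].
Hypothesis X_hd : hausdorff_space X.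
Hypothesis Y_hd : hausdorff_space Y.
Hypothesis p_lh : local_homeomorphism p.
Implicit Types f g : X -> Cx R.

Let p_cont : continuous p. Proof. by case: p_lh. Qed.

(** A fibre meets each set on which p is injective in at most one point, so the support meets it
    in a finite set. *)
Lemma fiber_finite f y : csupp setT f -> finite_set ([set x | p x = y] `&` [set x | f x != 0]).
Proof.
move=> csf; move: f csf; apply: csupp_rect => //.
- rewrite (_ : _ `&` _ = set0); first exact: finite_set0.
  by rewrite -subset0 => x [_ /=]; rewrite eqxx.
- move=> f g _ _ ff fg; apply: (@sub_finite_set _ _ (([set x | p x = y] `&` [set x | f x != 0]) `|` ([set x | p x = y] `&` [set x | g x != 0]))).
    move=> x [px /= fgx]; have [fx|fx] := eqVneq (f x) 0; last by left.
    by right; split => //=; move: fgx; rewrite fx add0r.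
  by rewrite finite_setU.
- move=> x _; have [U [oU Ux injU _]] := p_lh.2 x.
  exists U; split; [exact: oU|exact: Ux|] => f [_ [C [_ CU f0]]] _.
  have [[z [pz fz]]|nz] := pselect (exists z, p z = y /\ f z != 0).
    apply: (@sub_finite_set _ _ [set z]); last exact: finite_set1.
    move=> w [pw fw]; have CUz u : f u != 0 -> U u.
      by move=> fu; apply: CU; apply: contrapT => /f0 /eqP; rewrite (negPf fu).
    apply: injU; [by apply: mem_set; apply: CUz|by apply: mem_set; apply: CUz|].
    by rewrite pw pz.
  rewrite (_ : _ `&` _ = set0); first exact: finite_set0.
  by rewrite -subset0 => z [pz fz]; apply: nz; exists z.
Qed.

Lemma fiber_sumD f g : csupp setT f -> csupp setT g ->
  fiber_sum p (fun x => f x + g x) = (fun y => fiber_sum p f y + fiber_sum p g y).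
Proof.
move=> csf csg; apply/funext => y; rewrite /fiber_sum.
pose A := ([set x | p x = y] `&` [set x | f x != 0]) `|` ([set x | p x = y] `&` [set x | g x != 0]).
have fA : finite_set A by rewrite finite_setU; split; exact: fiber_finite.
have AP : A `<=` [set x | p x = y] by move=> x [[]|[]].
have A0 x : [set x | p x = y] x -> ~ A x -> f x = 0 /\ g x = 0.
  move=> px nA; split; apply/eqP; apply: contrapT => /negP nz; apply: nA; [left|right]; by [].
rewrite -!(@fsbig_widen _ _ _ _ A [set x | p x = y]) //.
- exact: fsbig_split.
- by move=> x [px nA]; have [] := A0 x px nA.
- by move=> x [px nA]; have [] := A0 x px nA.
- by move=> x [px nA] /=; have [-> ->] := A0 x px nA; rewrite addr0.
Qed.

Lemma fiber_sumZ (k : Cx R) f : fiber_sum p (fun x => k * f x) = (fun y => k * fiber_sum p f y).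
Proof. by apply/funext => y; rewrite /fiber_sum -mulr_fsumr. Qed.

Lemma fiber_sum0 : fiber_sum p (fun=> 0 : Cx R) = (fun=> 0).
Proof. by apply/funext => y; rewrite /fiber_sum fsbig1. Qed.

Lemma fiber_sum_eq0 f y : (forall x, p x = y -> f x = 0) -> fiber_sum p f y = 0.
Proof. by move=> H; rewrite /fiber_sum fsbig1. Qed.

Lemma fiber_sum_inj (U : set X) f x : set_inj U p -> (forall z, ~ U z -> f z = 0) -> U x ->
  fiber_sum p f (p x) = f x.
Proof.
move=> injU f0 Ux; rewrite /fiber_sum -(@fsbig_widen _ _ _ _ [set x]).
- by rewrite fsbig_set1.
- by move=> z ->.
- move=> z [pz zx] /=; have [Uz|/f0 //] := pselect (U z).
  by exfalso; apply: zx; apply: injU; [exact: mem_set|exact: mem_set|].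
Qed.

(** Where p is injective, the sum is f transported along the homeomorphism p from U onto its
    open image. *)
Lemma fiber_sum_csupp_local (U : set X) f : open U -> set_inj U p ->
  (forall V : set X, open V -> V `<=` U -> open (p @` V)) ->
  csupp U f -> csupp setT (fiber_sum p f).
Proof.
move=> oU injU openU [cf [C [cC CU f0]]].
have f0U z : ~ U z -> f z = 0 by move=> nUz; apply: f0 => /CU.
have cpC : compact (p @` C).
  by apply: compact_image.
apply: (@csupp_open _ _ setT (p @` U)) => //; first exact: openU.
  exists (p @` C); split; [exact: cpC|by apply: image_subset|].
  move=> y nC; apply: fiber_sum_eq0 => x px; apply: f0 => Cx; apply: nC.
  by exists x.
move=> _ [x Ux <-] B.
rewrite (fiber_sum_inj injU f0U Ux) => fB.
have nfB : nbhs x (f @^-1` B) := cf x _ fB.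
rewrite nbhsE in nfB; have [V [oV Vx] VB] := nfB.
have oVU : open (V `&` U) by exact: openI.
have : nbhs (p x) (p @` (V `&` U)).
  apply: open_nbhs_nbhs; split; last by exists x.
  by apply: openU => // z [].
apply: filterS => _ [z [Vz Uz] <-] /=.
by rewrite (fiber_sum_inj injU f0U Uz); exact: VB.
Qed.

Lemma fiber_sum_csupp f : csupp setT f -> csupp setT (fiber_sum p f).
Proof.
move=> csf; move: f csf; apply: csupp_rect => //.
- by rewrite fiber_sum0; exact: csupp0.
- by move=> f g csf csg cpf cpg; rewrite fiber_sumD //; exact: csuppD.
- move=> x _; have [U [oU Ux injU opU]] := p_lh.2 x.
  exists U; split; [exact: oU|exact: Ux|] => f csf _.
  exact: (fiber_sum_csupp_local oU injU opU csf).
Qed.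

Lemma fiber_sum_ge0 f y : (forall x, 0 <= f x) -> 0 <= fiber_sum p f y.
Proof. by move=> f0; rewrite /fiber_sum fsumr_ge0. Qed.

End fiber_sum.

(** * Etale groupoids and convolution *)

Section groupoid.
Context (R : realType) (G : topGroupoid).
Hypothesis G_lc : locally_compact [set: G].
Hypothesis G_hd : hausdorff_space G.
Hypothesis G_etale : etale G.
Local Notation X := (unit_space G).
Implicit Types (g h k : G) (x y : X) (f : G -> Cx R) (u v : X -> Cx R).

Lemma inv_uniq g h : src g = rng h -> mul g h = un (rng g) -> h = inv g.
Proof.
move=> gh gh1.
rewrite -(mul_un_l h) -gh -mul_inv_l -mulgA ?src_inv // gh1.
by rewrite -src_inv mul_un_r.
Qed.

Lemma invK g : inv (inv g) = g.
Proof. by symmetry; apply: inv_uniq; rewrite ?src_inv // mul_inv_l rng_inv. Qed.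

Lemma inv_un x : inv (un x) = un x.
Proof. by symmetry; apply: inv_uniq; rewrite ?src_un ?rng_un // -{1}(rng_un x) mul_un_l. Qed.

Lemma mulKinv h g : rng h = rng g -> mul h (mul (inv h) g) = g.
Proof. by move=> hg; rewrite mulgA ?rng_inv ?src_inv // mul_inv_r hg mul_un_l. Qed.

Lemma unit_space_hausdorff : hausdorff_space X.
Proof.
rewrite open_hausdorff => x y xy.
have unxy : un x != un y by apply: contra_neq xy => H; rewrite -(rng_un x) H rng_un.
have := G_hd; rewrite open_hausdorff => /(_ _ _ unxy) [[A B] /= [xA yB] [oA oB /eqP AB0]].
exists ((@un G) @^-1` A, (@un G) @^-1` B) => /=; first by split; apply: mem_set; apply: set_mem.
split; try by apply: open_comp => // ? _; exact: un_continuous.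
by apply/eqP; rewrite -preimage_setI AB0 preimage_set0.
Qed.

Definition units : set G := [set g | g = un (rng g)].

Lemma units_un x : units (un x). Proof. by rewrite /units /= rng_un. Qed.

Lemma unrng_continuous : continuous (fun g : G => un (rng g)).
Proof. by apply: cont_comp; [exact: rng_continuous|exact: un_continuous]. Qed.

(** Units are the arrows fixed by the continuous map g |-> un (rng g). *)
Lemma units_closed : closed units.
Proof.
rewrite -(setCK units); apply: open_closedC; rewrite openE => g /= gu.
have ne : g != un (rng g) by apply/eqP.
have := G_hd; rewrite open_hausdorff => /(_ _ _ ne) [[A B] /= [/set_mem gA /set_mem gB] [oA oB /eqP AB0]].
have : nbhs g (A `&` (fun h => un (rng h)) @^-1` B).
  apply: filterI; first exact: open_nbhs_nbhs.
  by apply: unrng_continuous; exact: open_nbhs_nbhs.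
apply: filterS => h [Ah Bh] hu.
by have : (A `&` B) h by [split => //; rewrite hu]; rewrite AB0.
Qed.

(** The range map sends the units of a compact neighbourhood of un x onto a neighbourhood of
    x. *)
Lemma unit_space_locally_compact : locally_compact [set: X].
Proof.
move=> x _; have [U nU [cU clU]] := G_lc (I : [set: G] (un x)).
have cV : compact ((@rng G) @` (U `&` units)).
  apply: continuous_compact.
    by apply: continuous_subspaceT; exact: rng_continuous.
  by apply: compact_closedI => //; exact: units_closed.
exists ((@rng G) @` (U `&` units)); last first.
  by split => //; apply: compact_closed => //; exact: unit_space_hausdorff.
have : nbhs x ((@un G) @^-1` U).
  apply: un_continuous; move: nU; rewrite /within /=.
  by apply: filterS => g; exact.
apply: filterS => y Uy _; exists (un y); last exact: rng_un.
by split => //; exact: units_un.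
Qed.

(** If rng is injective on a neighbourhood U of a unit, then an arrow h of U such that
    un (rng h) lies in U too has the same range as un (rng h), and equals it. *)
Lemma units_open : open units.
Proof.
rewrite openE => g /= gu.
have [U [oU Ug injU _]] := G_etale.2 g.
have : nbhs g (U `&` (fun h => un (rng h)) @^-1` U).
  apply: filterI; first exact: open_nbhs_nbhs.
  by apply: unrng_continuous; rewrite -gu; exact: open_nbhs_nbhs.
apply: filterS => h [Uh Urh]; rewrite /units /=.
by apply: injU; [exact: mem_set|exact: mem_set|rewrite rng_un].
Qed.

(** Inversion is a homeomorphism, and src is the composite of rng with it. *)
Lemma src_local_homeomorphism : local_homeomorphism (@src G).
Proof.
split; first exact: src_continuous.
move=> g; have [U [oU Ug injU opU]] := G_etale.2 (inv g).
exists ((@inv G) @^-1` U); split => //.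
- by apply: open_comp => // ? _; exact: inv_continuous.
- move=> a b Ua Ub ab; rewrite -(invK a) -(invK b); congr inv.
  apply: injU; [by move: Ua => /set_mem ?; exact: mem_set|by move: Ub => /set_mem ?; exact: mem_set|].
  by rewrite !rng_inv.
- move=> V oV VU.
  have -> : (@src G) @` V = (@rng G) @` ((@inv G) @^-1` V).
    apply/seteqP; split => _ [h Vh <-].
      by exists (inv h); rewrite ?rng_inv //= invK.
    by exists (inv h) => //; rewrite src_inv.
  apply: opU; first by apply: open_comp => // ? _; exact: inv_continuous.
  by move=> h /VU /=; rewrite invK.
Qed.

Definition bisection (U : set G) := [/\ open U, set_inj U (@rng G) & set_inj U (@src G)].

Lemma bisection_nbhs g : exists U, bisection U /\ U g.
Proof.
have [U [oU Ug injU _]] := G_etale.2 g.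
have [V [oV Vg injV _]] := src_local_homeomorphism.2 g.
exists (U `&` V); split => //; split; first exact: openI.
  by move=> a b /set_mem[Ua _] /set_mem[Ub _]; apply: injU; exact: mem_set.
by move=> a b /set_mem[_ Va] /set_mem[_ Vb]; apply: injV; exact: mem_set.
Qed.

Definition unit_ext u : G -> Cx R := fun g => if g == un (rng g) then u (rng g) else 0.

Lemma unit_ext_un u x : unit_ext u (un x) = u x.
Proof. by rewrite /unit_ext rng_un eqxx. Qed.

Lemma unit_ext_in u g : units g -> unit_ext u g = u (rng g).
Proof. by rewrite /units /= /unit_ext => <-; rewrite eqxx. Qed.

Lemma unit_ext_out u g : ~ units g -> unit_ext u g = 0.
Proof. by rewrite /units /= /unit_ext; case: eqP. Qed.

Lemma unit_ext_csupp u : csupp setT u -> csupp setT (unit_ext u).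
Proof.
move=> [cu [C [cC _ u0]]].
apply: (@csupp_open _ _ setT units) => //; first exact: units_open.
  exists ((@un G) @` C); split.
  - apply: compact_image => //; exact: un_continuous.
  - by move=> _ [x _ <-]; exact: units_un.
  - move=> g nC; have [gu|/unit_ext_out //] := pselect (units g).
    by rewrite unit_ext_in // u0 // => Cg; apply: nC; exists (rng g).
move=> g gu; rewrite (unit_ext_in u gu).
apply: (@cvg_trans _ ((fun h => u (rng h)) k @[k --> g])).
  apply: near_eq_cvg; have : nbhs g units by apply: open_nbhs_nbhs; split => //; exact: units_open.
  by apply: filterS => h hu; rewrite unit_ext_in.
exact: (cont_comp (@rng_continuous G) cu).
Qed.

Lemma unit_extD u v : unit_ext (fun x => u x + v x) = (fun g => unit_ext u g + unit_ext v g).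
Proof. by apply/funext => g; rewrite /unit_ext; case: ifP => // _; rewrite addr0. Qed.

Lemma unit_extZ (k : Cx R) u : unit_ext (fun x => k * u x) = (fun g => k * unit_ext u g).
Proof. by apply/funext => g; rewrite /unit_ext; case: ifP => // _; rewrite mulr0. Qed.

Lemma invol_unit_ext u : invol (unit_ext u) = unit_ext (fun x => Num.conj (u x)).
Proof.
apply/funext => g; rewrite /invol.
have [gu|ngu] := pselect (units g).
  by rewrite gu inv_un !unit_ext_un.
rewrite !unit_ext_out ?rmorph0 // => /= giu; apply: ngu.
by rewrite -(invK g) giu inv_un; exact: units_un.
Qed.

Lemma conv_unit_ext_l u f : conv (unit_ext u) f = (fun g => u (rng g) * f g).
Proof.
apply/funext => g; rewrite /conv -(@fsbig_widen _ _ _ _ [set un (rng g)]).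
- by rewrite fsbig_set1 unit_ext_un inv_un mul_un_l.
- by move=> h ->; rewrite /= rng_un.
- move=> h [/= hg nh]; rewrite unit_ext_out ?mul0r // => hu; apply: nh.
  by rewrite /= hu hg.
Qed.

Lemma unit_mul_inv h g : rng h = rng g -> units (mul (inv h) g) -> h = g.
Proof.
move=> hg ku; rewrite -[RHS](mulKinv hg) ku rng_mul ?src_inv // rng_inv.
by rewrite mul_un_r.
Qed.

Lemma conv_unit_ext_r f u : conv f (unit_ext u) = (fun g => f g * u (src g)).
Proof.
apply/funext => g; rewrite /conv -(@fsbig_widen _ _ _ _ [set g]).
- by rewrite fsbig_set1 mul_inv_l unit_ext_un.
- by move=> h ->.
- move=> h [/= hg nh]; rewrite unit_ext_out ?mulr0 // => hu; apply: nh.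
  exact: unit_mul_inv.
Qed.

(** In the sum defining the convolution at g, a nonzero term has inv h and inv h * g in U.  Both
    have range src h, so they coincide and g is a unit.  On a unit the sum runs over the arrows
    inv h with a prescribed source. *)
Lemma conv_invol_l (U : set G) f f' : set_inj U (@rng G) ->
  (forall g, ~ U g -> f g = 0) -> (forall g, ~ U g -> f' g = 0) ->
  conv (invol f) f' = unit_ext (fiber_sum (@src G) (fun g => Num.conj (f g) * f' g)).
Proof.
move=> injU f0 f'0; apply/funext => g; rewrite /conv /invol.
have [gu|ngu] := pselect (units g); last first.
  rewrite unit_ext_out // fsbig1 // => h hg.
  have [Ua|/f0 ->] := pselect (U (inv h)); last by rewrite rmorph0 mul0r.
  have [Ub|/f'0 ->] := pselect (U (mul (inv h) g)); last by rewrite mulr0.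
  exfalso; apply: ngu.
  have ab : inv h = mul (inv h) g.
    by apply: injU; [exact: mem_set|exact: mem_set|rewrite rng_mul ?src_inv].
  by rewrite -(mulKinv hg) -ab mul_inv_r; exact: units_un.
rewrite unit_ext_in // /fiber_sum [RHS](@reindex_fsbig _ _ _ _ _ (@inv G) [set h | rng h = rng g]); last first.
  split.
  - by move=> h /= hg; rewrite src_inv.
  - by move=> a b _ _ ab; rewrite -(invK a) ab invK.
  - by move=> h /= hg; exists (inv h); rewrite /= ?rng_inv ?invK.
apply: eq_fsbigr => h /set_mem /= hg; congr (_ * f' _).
by rewrite gu -hg -src_inv mul_un_r.
Qed.

(** As for [conv_invol_l]: now h and inv g * h lie in U and have the same source. *)
Lemma conv_invol_r (U : set G) f f' : set_inj U (@src G) ->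
  (forall g, ~ U g -> f g = 0) -> (forall g, ~ U g -> f' g = 0) ->
  conv f (invol f') = unit_ext (fiber_sum (@rng G) (fun g => f g * Num.conj (f' g))).
Proof.
move=> injU f0 f'0; apply/funext => g; rewrite /conv /invol.
have [gu|ngu] := pselect (units g); last first.
  rewrite unit_ext_out // fsbig1 // => h hg.
  have [Ua|/f0 ->] := pselect (U h); last by rewrite mul0r.
  have [Ub|/f'0 ->] := pselect (U (inv (mul (inv h) g))); last by rewrite rmorph0 mulr0.
  exfalso; apply: ngu.
  have ab : h = inv (mul (inv h) g).
    by apply: injU; [exact: mem_set|exact: mem_set|rewrite src_inv rng_mul ?src_inv // rng_inv].
  by rewrite -(mulKinv hg) -[mul (inv h) g]invK -ab mul_inv_r; exact: units_un.
rewrite unit_ext_in // /fiber_sum; apply: eq_fsbigr => h /set_mem /= hg.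
congr (_ * Num.conj (f' _)).
by rewrite gu -hg -src_inv mul_un_r invK.
Qed.

End groupoid.

(** * The complex exponential near zero *)

Section estimates.
Context (R : realType).
Implicit Types (x y a b s : R).

Lemma sin_mvt x : exists2 y, `|y| <= `|x| & sin x = cos y * x.
Proof.
have pos (u : R) : 0 <= u -> exists2 y : R, `|y| <= `|u| & sin u = cos y * u.
  move=> u0; have [|y yu] := @MVT_segment R sin cos 0 u u0.
    by apply: continuous_subspaceT; exact: continuous_sin.
  rewrite sin0 !subr0 => su; exists y => //.
  by move: yu; rewrite in_itv /= => /andP[y0 yu]; rewrite !ger0_norm.
have [x0|x0] := leP 0 x; first exact: pos.
have [|y yx] := pos (- x); first by rewrite oppr_ge0 ltW.
rewrite sinN mulrN => /oppr_inj sx; exists y => //; by rewrite normrN in yx.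
Qed.

Lemma cos_sub1 x : `|cos x - 1| <= x ^+ 2 / 2.
Proof.
have [y _ sy] := sin_mvt (x / 2).
have cx : cos x - 1 = - 2 * sin (x / 2) ^+ 2.
  have := cosD (x / 2) (x / 2); rewrite -splitr -!expr2 => ->.
  have := cos2Dsin2 (x / 2); lra.
rewrite cx normrM normrN normr_nat ger0_norm ?sqr_ge0 // sy exprMn.
have : cos y ^+ 2 <= 1 by have := cos2Dsin2 y; have := sqr_ge0 (sin y); lra.
have := sqr_ge0 x; have -> : (x / 2) ^+ 2 = x ^+ 2 / 4 by field.
nra.
Qed.

Lemma sin_subx x : `|x| <= 1 -> `|sin x - x| <= x ^+ 2.
Proof.
move=> x1; have [y yx ->] := sin_mvt x.
have -> : cos y * x - x = (cos y - 1) * x by ring.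
rewrite normrM -[leRHS]real_normK ?num_real //.
have := cos_sub1 y; rewrite -(real_normK (num_real y)).
have := normr_ge0 x; have := normr_ge0 y; have := normr_ge0 (cos y - 1).
move=> y0 x0 A0 H; have yx2 : `|y| ^+ 2 <= `|x| ^+ 2 by rewrite ler_sqr ?nnegrE.
apply: (@le_trans _ _ `|cos y - 1|); first by rewrite ler_piMr.
by apply: (le_trans H); apply: le_trans yx2; rewrite ler_pdivrMr // ler_peMr // ?sqr_ge0 // ler1n.
Qed.

Lemma expR_sub1x b : `|b| <= 2^-1 -> `|expR b - 1 - b| <= 2 * b ^+ 2.
Proof.
move=> /ler_normlP[b1 b2].
have e1 := expR_ge1Dx b; have e2 := expR_ge1Dx (- b).
have eb : expR b * expR (- b) = 1 by rewrite -expRD subrr expR0.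
have e0 := expR_gt0 b.
rewrite ger0_norm; last by lra.
have : expR b * (1 - b) <= 1 by rewrite -[leRHS]eb (ler_pM2l e0).
nra.
Qed.

(** The exponential of i z s for complex z and real s. *)
Definition expiz (z : Cx R) s : Cx R := rc (expR (- Imc z * s)) * expi (Rec z * s).

Lemma expizD z w s : expiz (z + w) s = expiz z s * expiz w s.
Proof.
rewrite /expiz RecD ImcD opprD !mulrDl expRD expiD rcM -!mulrA; congr (_ * _).
by rewrite mulrCA.
Qed.

Lemma expi0 : expi (0 : R) = 1.
Proof. by rewrite /expi cos0 sin0. Qed.

Lemma expiz_real t s : expiz (toCx t 0) s = expi (t * s).
Proof. by rewrite /expiz !CxE oppr0 mul0r expR0 rc1 mul1r. Qed.

Lemma expiz_imag b s : expiz (toCx 0 b) s = rc (expR (- b * s)).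
Proof. by rewrite /expiz !CxE mul0r expi0 mulr1. Qed.

Lemma expiz_continuous z : continuous (expiz z).
Proof.
apply: contM.
  apply: (@cont_comp _ _ _ (fun s : R => expR (- Imc z * s)) (@rc R)); last exact: rc_continuous.
  apply: (@cont_comp _ _ _ (fun s : R => - Imc z * s) expR); last exact: continuous_expR.
  by apply: contZ => ?; exact: cvg_id.
apply: (@cont_comp _ _ _ (fun s : R => Rec z * s) (@expi R)); last exact: expi_continuous.
by apply: contZ => ?; exact: cvg_id.
Qed.

(** Second-order Taylor estimate.  With i z s = b + i a, the remainder is
    (e^b - 1 - b) e^(ia) + (1 + b) (e^(ia) - 1 - i a) + i a b, and each term is at most a constant
    times |z s|^2. *)
Lemma expiz_remainder (z : Cx R) s : nrm z * `|s| <= 2^-1 ->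
  nrm (expiz z s - 1 - ic R * z * rc s) <= 10 * (nrm z * `|s|) ^+ 2.
Proof.
move=> zs; pose a := Rec z * s; pose b := - Imc z * s.
have zs0 : 0 <= nrm z * `|s| by rewrite mulr_ge0 ?nrm_ge0.
have aZ : `|a| <= nrm z * `|s| by rewrite normrM ler_wpM2r // nrm_Rec.
have bZ : `|b| <= nrm z * `|s| by rewrite normrM normrN ler_wpM2r // nrm_Imc.
have -> : expiz z s - 1 - ic R * z * rc s = toCx (expR b * cos a - 1 - b) (expR b * sin a - a).
  by apply: Cx_eqP; rewrite /expiz !CxE /a /b /=; ring.
apply: (le_trans (nrm_le _)); rewrite !CxE.
have E := @expR_sub1x b ltac:(lra).
have Cc := cos_sub1 a.
have S := @sin_subx a ltac:(lra).
have a2 : a ^+ 2 <= (nrm z * `|s|) ^+ 2.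
  by rewrite -(real_normK (num_real a)) ler_sqr ?nnegrE.
have b2 : b ^+ 2 <= (nrm z * `|s|) ^+ 2.
  by rewrite -(real_normK (num_real b)) ler_sqr ?nnegrE.
have ab : `|a * b| <= (nrm z * `|s|) ^+ 2.
  by rewrite normrM expr2 ler_pM.
have b1 : `|1 + b| <= 2.
  by apply: (le_trans (ler_normD _ _)); rewrite normr1; lra.
have -> : expR b * cos a - 1 - b = (expR b - 1 - b) * cos a + (1 + b) * (cos a - 1) by ring.
have -> : expR b * sin a - a = (expR b - 1 - b) * sin a + ((1 + b) * (sin a - a) + a * b) by ring.
have n1 : `|(expR b - 1 - b) * cos a| <= 2 * b ^+ 2.
  by rewrite normrM; apply: le_trans (ler_pM _ _ E (cos_max a)) _; rewrite ?mulr1.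
have n2 : `|(expR b - 1 - b) * sin a| <= 2 * b ^+ 2.
  by rewrite normrM; apply: le_trans (ler_pM _ _ E (sin_max a)) _; rewrite ?mulr1.
have n3 : `|(1 + b) * (cos a - 1)| <= 2 * (a ^+ 2 / 2) by rewrite normrM ler_pM.
have n4 : `|(1 + b) * (sin a - a)| <= 2 * a ^+ 2 by rewrite normrM ler_pM.
have t1 := ler_normD ((expR b - 1 - b) * cos a) ((1 + b) * (cos a - 1)).
have t2 := ler_normD ((expR b - 1 - b) * sin a) ((1 + b) * (sin a - a) + a * b).
have t3 := ler_normD ((1 + b) * (sin a - a)) (a * b).
apply: (le_trans (lerD t1 t2)).
apply: (le_trans (lerD (lerD n1 n3) (lerD n2 (le_trans t3 (lerD n4 ab))))).
have := sqr_ge0 (nrm z * `|s|); lra.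
Qed.

Lemma expi_neq1 y : 0 < `|y| <= 1 -> expi y != 1.
Proof.
move=> /andP[y0 y1]; apply/eqP => /(congr1 (@Imc R)); rewrite /expi !CxE => sy.
have s0 x : 0 < x <= 1 -> sin x != 0.
  move=> /andP[x0 x1]; rewrite gt_eqF // sin_gt0_pi // x0 /=.
  by apply: (le_lt_trans x1); apply: lt_le_trans (pi_ge2 R); rewrite ltr1n.
have [yp|yn|yz] := ltgtP y 0.
- have := s0 (- y); rewrite oppr_gt0 yp sinN sy oppr0 eqxx.
  by move: y1; rewrite ltr0_norm // => -> /(_ isT).
- have := s0 y; rewrite yn sy eqxx.
  by move: y1; rewrite gtr0_norm // => -> /(_ isT).
- by move: y0; rewrite yz normr0 ltxx.
Qed.

End estimates.

(** * Norm estimates in the groupoid C*-algebra *)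

Section realnorm.
Context (R : realType) (V : normedModType (Cx R)).
Implicit Types a b : V.

Definition rnorm a : R := Rec `|a|.

Lemma norm_rnorm a : `|a| = rc (rnorm a). Proof. exact: ge0_rc. Qed.
Lemma rnorm_ge0 a : 0 <= rnorm a. Proof. exact: ge0_Rec. Qed.
Lemma rnorm_leP a (M : R) : (`|a| <= rc M) = (rnorm a <= M).
Proof. by rewrite norm_rnorm le_rc. Qed.
Lemma rnormD a b : rnorm (a + b) <= rnorm a + rnorm b.
Proof. by rewrite -le_rc rcD -!norm_rnorm ler_normD. Qed.
Lemma rnormZ (k : Cx R) a : rnorm (k *: a) = nrm k * rnorm a.
Proof. by apply: (@rc_inj R); rewrite rcM -!norm_rnorm -rc_nrm normrZ. Qed.
End realnorm.

Section hilbert.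
Context (R : realType) (H : hilbertSpace R).
Implicit Types x y z : H.

Lemma dotpDl x y z : dotp (x + y) z = dotp x z + dotp y z.
Proof. by have := dotp_linear_l 1 x y z; rewrite scale1r mul1r. Qed.

Lemma dotpDr x y z : dotp z (x + y) = dotp z x + dotp z y.
Proof. by rewrite (dotp_conj (x + y) z) (dotp_conj x z) (dotp_conj y z) dotpDl; exact: rmorphD. Qed.

Lemma dotp0l z : dotp 0 z = 0.
Proof. by apply: (@addrI _ (dotp 0 z)); rewrite -dotpDl !addr0. Qed.

Lemma dotpZl (k : Cx R) x z : dotp (k *: x) z = k * dotp x z.
Proof. by have := dotp_linear_l k x 0 z; rewrite addr0 dotp0l addr0. Qed.

Lemma dotpZr (k : Cx R) x z : dotp z (k *: x) = Num.conj k * dotp z x.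
Proof. by rewrite (dotp_conj (k *: x) z) (dotp_conj x z) dotpZl; exact: rmorphM. Qed.

Lemma dotp_rnorm x : dotp x x = rc (rnorm x ^+ 2).
Proof. by rewrite dotp_norm norm_rnorm rcX. Qed.

Lemma Rec_dotpC x y : Rec (dotp y x) = Rec (dotp x y).
Proof. by rewrite dotp_conj Rec_conj. Qed.

Lemma Rec_dotp_le x y : 2 * Rec (dotp x y) <= rnorm x ^+ 2 + rnorm y ^+ 2.
Proof.
have := sqr_ge0 (rnorm (x - y)).
have -> : rnorm (x - y) ^+ 2 = Rec (dotp (x - y) (x - y)) by rewrite dotp_rnorm.
rewrite dotpDl !dotpDr -scaleN1r !dotpZl !dotpZr !dotp_rnorm rmorphN rmorph1 !mulN1r opprK.
rewrite !CxE (Rec_dotpC x y); lra.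
Qed.
End hilbert.

Section bounds.
Context (R : realType) (G : topGroupoid).
Hypothesis G_lc : locally_compact [set: G].
Hypothesis G_hd : hausdorff_space G.
Hypothesis G_etale : etale G.
Local Notation X := (unit_space G).
Implicit Types (g h k : G) (f : G -> Cx R) (u v : X -> Cx R).

Let X_lc : locally_compact [set: X] := unit_space_locally_compact G_lc G_hd.
Let X_hd : hausdorff_space X := unit_space_hausdorff G_hd.
Let toCc f : csupp setT f -> Cc f := (Cc_csupp G_hd f).2.

Lemma conv_unit_ext u v : conv (unit_ext u) (unit_ext v) = unit_ext (fun x => u x * v x).
Proof.
rewrite conv_unit_ext_l; apply/funext => g.
have [gu|ngu] := pselect (units g); first by rewrite !unit_ext_in.
by rewrite !unit_ext_out // mulr0.
Qed.

Lemma csupp_sqrt (u : X -> Cx R) (w : X -> R) : csupp setT u -> csupp setT w ->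
  (forall x, nrm (u x) ^+ 2 <= w x) ->
  csupp setT (fun x => rc (Num.sqrt (w x - nrm (u x) ^+ 2))).
Proof.
move=> [cu _] [cw [C [cC _ w0]]] uw; split; last first.
  exists C; split => // x nC; have := uw x; rewrite w0 // => u0.
  by rewrite ler0_sqrtr // sub0r oppr_le0 sqr_ge0.
have cn : continuous (fun x => w x - (Rec (u x) ^+ 2 + Imc (u x) ^+ 2)).
  have cR := cont_comp cu (@Rec_continuous R).
  have cI := cont_comp cu (@Imc_continuous R).
  by apply: contB => //; apply: contD; apply: contM.
have -> : (fun x => rc (Num.sqrt (w x - nrm (u x) ^+ 2))) =
    (fun x => rc (Num.sqrt (w x - (Rec (u x) ^+ 2 + Imc (u x) ^+ 2)))).
  by apply/funext => x; rewrite nrm_sq.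
apply: cont_comp (@rc_continuous R); apply: (cont_comp cn); exact: sqrt_continuous.
Qed.

Section representation.
Context (H : hilbertSpace R) (p : (G -> Cx R) -> H -> H).
Hypothesis p_repr : representation p.

Lemma repr_add f f' xi : csupp setT f -> csupp setT f' ->
  p (fun g => f g + f' g) xi = p f xi + p f' xi.
Proof.
move=> /toCc cf /toCc cf'; have := repr_lin p_repr 1 cf cf' xi; rewrite scale1r => <-.
by congr (p _ xi); apply/funext => g; rewrite mul1r.
Qed.

Lemma repr_scale (k : Cx R) f xi : csupp setT f -> p (fun g => k * f g) xi = k *: p f xi.
Proof.
move=> /toCc cf; have := repr_lin p_repr (k - 1) cf cf xi.
rewrite scalerBl scale1r subrK => <-.
by congr (p _ xi); apply/funext => g; rewrite mulrBl mul1r subrK.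
Qed.

Lemma repr_unit_ext_dot u xi : csupp setT u ->
  rnorm (p (unit_ext u) xi) ^+ 2 = Rec (dotp xi (p (unit_ext (fun x => rc (nrm (u x) ^+ 2))) xi)).
Proof.
move=> csu; have ceu := toCc (unit_ext_csupp G_hd G_etale csu).
have cconj := csupp_conj csu.
have ceu' := toCc (unit_ext_csupp G_hd G_etale cconj).
have : dotp (p (unit_ext u) xi) (p (unit_ext u) xi) = rc (rnorm (p (unit_ext u) xi) ^+ 2) by exact: dotp_rnorm.
move=> /(congr1 (@Rec R)); rewrite Rec_rc => <-.
rewrite (repr_star p_repr ceu) invol_unit_ext -(repr_mul p_repr ceu' ceu) conv_unit_ext.
congr (Rec (dotp xi (p _ xi))); congr unit_ext; apply/funext => x; exact: conjM_nrm.
Qed.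

(** If |u|^2 <= w, then w - |u|^2 = |v|^2 with v its square root, again in C_c(X), so
    <p(w) xi, xi> = |p(u) xi|^2 + |p(v) xi|^2. *)
Lemma repr_unit_ext_le u (w : X -> R) xi : csupp setT u -> csupp setT w ->
  (forall x, nrm (u x) ^+ 2 <= w x) ->
  rnorm (p (unit_ext u) xi) ^+ 2 <= Rec (dotp xi (p (unit_ext (fun x => rc (w x))) xi)).
Proof.
move=> csu csw uw; have csg := csupp_sqrt csu csw uw.
have eu := repr_unit_ext_dot xi csu; have eg := repr_unit_ext_dot xi csg.
have csq v : csupp setT v -> csupp setT (unit_ext (fun x => rc (nrm (v x) ^+ 2))).
  move=> csv; apply: unit_ext_csupp => //.
  have -> : (fun x => rc (nrm (v x) ^+ 2)) = (fun x => Num.conj (v x) * v x).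
    by apply/funext => x; rewrite conjM_nrm.
  exact: (csuppMl (csupp_conj csv).1 csv).
have -> : unit_ext (fun x => rc (w x)) = (fun g => unit_ext (fun x => rc (nrm (u x) ^+ 2)) g +
    unit_ext (fun x => rc (nrm (rc (Num.sqrt (w x - nrm (u x) ^+ 2))) ^+ 2)) g).
  rewrite -unit_extD; congr unit_ext; apply/funext => x; rewrite -rcD; congr rc.
  rewrite nrm_rc ger0_norm ?sqrtr_ge0 // sqr_sqrtr; first by rewrite addrC subrK.
  by rewrite subr_ge0.
rewrite repr_add; [|exact: csq|exact: csq].
by rewrite dotpDr RecD -eu -eg lerDl sqr_ge0.
Qed.

(** Let e be a bump function, 0 <= e <= 1, equal to 1 on the support of u.  Since e^2 <= e,
    |p(e) xi|^2 <= <p(e) xi, xi>, which forces <p(e) xi, xi> <= |xi|^2; and since |u|^2 <= M^2 e,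
    |p(u) xi|^2 <= M^2 <p(e) xi, xi>. *)
Lemma repr_unit_ext_bound u (M : R) xi : csupp setT u -> 0 <= M ->
  (forall x, nrm (u x) <= M) -> rnorm (p (unit_ext u) xi) <= M * rnorm xi.
Proof.
move=> csu M0 uM; have [cu [C [cC _ u0]]] := csu.
have [e [D [W [ce e01 [cD _ e0] [_ CW e1]]]]] :=
  @lch_urysohn R X X_lc X_hd C setT cC openT (fun _ _ => I).
have cse : csupp setT e by split => //; exists D.
have csre : csupp setT (fun x => rc (e x)) by exact: csupp_rc.
have e2 x : nrm (rc (e x)) ^+ 2 <= e x.
  have /andP[a b] := e01 x; rewrite nrm_rc ger0_norm // expr2; nra.
have H1 := repr_unit_ext_le xi csre cse e2.
have H2 := Rec_dotp_le xi (p (unit_ext (fun x => rc (e x))) xi).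
have csM : csupp setT (fun x => M ^+ 2 * e x) by exact: csuppZ.
have uMe x : nrm (u x) ^+ 2 <= M ^+ 2 * e x.
  have [Cx|nCx] := pselect (C x).
    by rewrite e1 ?mulr1 ?ler_sqr ?nnegrE ?nrm_ge0 //; exact: CW.
  rewrite u0 // nrm_rc normr0 expr0n /= mulr_ge0 ?sqr_ge0 //.
  by have /andP[] := e01 x.
have := repr_unit_ext_le xi csu csM uMe.
have -> : unit_ext (fun x => rc (M ^+ 2 * e x)) = (fun g => rc (M ^+ 2) * unit_ext (fun x => rc (e x)) g).
  by rewrite -unit_extZ; congr unit_ext; apply/funext => x; rewrite rcM.
rewrite repr_scale; last exact: unit_ext_csupp.
rewrite dotpZr !CxE oppr0 mul0r subr0 => H3.
rewrite -ler_sqr ?nnegrE ?rnorm_ge0 ?mulr_ge0 ?rnorm_ge0 // exprMn.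
apply: (le_trans H3); apply: ler_wpM2l; first exact: sqr_ge0.
lra.
Qed.

End representation.

Variables (A : cstarAlg R) (iota : (G -> Cx R) -> A).
Hypothesis A_full : full_groupoid_algebra iota.

Lemma iotaD f f' : csupp setT f -> csupp setT f' ->
  iota (fun g => f g + f' g) = iota f + iota f'.
Proof.
move=> /toCc cf /toCc cf'; have := iota_linear A_full 1 cf cf'; rewrite scale1r => <-.
by congr iota; apply/funext => g; rewrite mul1r.
Qed.

Lemma iotaZ (k : Cx R) f : csupp setT f -> iota (fun g => k * f g) = k *: iota f.
Proof.
move=> /toCc cf; have := iota_linear A_full (k - 1) cf cf.
rewrite scalerBl scale1r subrK => <-.
by congr iota; apply/funext => g; rewrite mulrBl mul1r subrK.
Qed.

Lemma iotaM f f' : csupp setT f -> csupp setT f' ->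
  iota (conv f f') = cmul (iota f) (iota f').
Proof. by move=> /toCc cf /toCc cf'; exact: iota_mul. Qed.

Lemma iotaV f : csupp setT f -> iota (invol f) = cstar (iota f).
Proof. by move=> /toCc cf; exact: iota_star. Qed.

Lemma iota_unit_ext_bound u (M : R) : csupp setT u -> 0 <= M ->
  (forall x, nrm (u x) <= M) -> rnorm (iota (unit_ext u)) <= M.
Proof.
move=> csu M0 uM; rewrite -rnorm_leP; apply: (iota_norm_lub A_full).
- exact/toCc/unit_ext_csupp.
- by rewrite rc_ge0.
- move=> H p rp x; rewrite !norm_rnorm -rcM le_rc.
  exact: repr_unit_ext_bound.
Qed.

Lemma csupp_invol f : csupp setT f -> csupp setT (invol f).
Proof.
move=> [cf [C [cC _ f0]]]; split.
  apply: (cont_comp _ (@conj_continuous R)).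
  exact: (cont_comp (@inv_continuous G) cf).
exists ((@inv G) @` C); split => //.
  by apply: compact_image => //; exact: inv_continuous.
move=> g nC; rewrite /invol f0 ?rmorph0 // => Cg; apply: nC; exists (inv g) => //.
exact: invK.
Qed.

(** By the C*-identity |f|^2 is the norm of f^* * f, which lives on units, where the norm is at
    most the sup norm; its value at a source of the support is |f|^2 there. *)
Lemma iota_bisection_bound (U : set G) f (M : R) : bisection U -> csupp U f -> 0 <= M ->
  (forall g, nrm (f g) <= M) -> rnorm (iota f) <= M.
Proof.
move=> [oU rU sU] csf M0 fM.
have csT : csupp setT f by exact: csupp_sub csf.
have [_ [C [_ CU f0]]] := csf.
have f0U g : ~ U g -> f g = 0 by move=> nUg; apply: f0 => /CU.
have csff : csupp setT (fun g => Num.conj (f g) * f g).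
  by apply: csuppMr; [exact: csT.1|exact: csupp_conj].
have ff0 g : ~ U g -> Num.conj (f g) * f g = 0 by move=> /f0U ->; rewrite mulr0.
have H : rnorm (iota (conv (invol f) f)) <= M ^+ 2.
  rewrite (conv_invol_l rU f0U f0U); apply: iota_unit_ext_bound.
  - by apply: fiber_sum_csupp => //; exact: src_local_homeomorphism.
  - exact: sqr_ge0.
  - move=> x; have [[g [Ug gx]]|nx] := pselect (exists g, U g /\ src g = x).
      rewrite -gx (fiber_sum_inj sU ff0 Ug) conjM_nrm nrm_rc ger0_norm ?sqr_ge0 //.
      by rewrite ler_sqr ?nnegrE ?nrm_ge0.
    rewrite fiber_sum_eq0 ?nrm_rc ?normr0 ?sqr_ge0 //.
    by move=> g gx; apply: ff0 => Ug; apply: nx; exists g.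
have := cstar_identity (iota f).
rewrite -iotaV // -iotaM //; last exact: csupp_invol.
rewrite !norm_rnorm -rcX => /(@rc_inj R) E.
by rewrite -ler_sqr ?nnegrE ?rnorm_ge0 // -E.
Qed.

(** The constants depend on f only, not on phi.  For f supported in a bisection this is
    [iota_bisection_bound]; sums are handled by adding constants. *)
Lemma iota_mult_bound f : csupp setT f ->
  exists (B : R) (L : set G), [/\ 0 <= B, compact L &
    forall (phi : G -> Cx R) (M : R), continuous phi -> 0 <= M ->
      (forall g, L g -> nrm (phi g) <= M) ->
      rnorm (iota (fun g => phi g * f g)) <= B * M].
Proof.
move: f; apply: (csupp_rect G_lc G_hd).
- exists 0, set0; split => //; first exact: compact0.
  move=> phi M _ M0 _; rewrite mul0r.
  rewrite (_ : (fun g => _) = (fun g => 0 * (0 : Cx R))); last first.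
    by apply/funext => g; rewrite !mulr0.
  rewrite iotaZ; last exact: csupp0.
  by rewrite scale0r /rnorm normr0.
- move=> f f' csf csf' [B [L [B0 cL HB]]] [B' [L' [B'0 cL' HB']]].
  exists (B + B'), (L `|` L'); split; [exact: addr_ge0|exact: compactU|].
  move=> phi M cphi M0 HM.
  rewrite (_ : (fun g => _) = (fun g => phi g * f g + phi g * f' g)); last first.
    by apply/funext => g; rewrite mulrDr.
  rewrite iotaD; [|exact: csuppMl|exact: csuppMl].
  rewrite mulrDl; apply: (le_trans (rnormD _ _)); apply: lerD.
    by apply: HB => // g Lg; apply: HM; left.
  by apply: HB' => // g Lg; apply: HM; right.
- move=> g _; have [U [bU Ug]] := bisection_nbhs G_etale g.
  have [oU _ _] := bU.
  exists U; split; [exact: oU|exact: Ug|] => f csf _.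
  have csT : csupp setT f by exact: csupp_sub csf.
  have [cf [C [cC CU f0]]] := csf.
  have [B1 B10 HB1] := csupp_bounded (csupp_Rec csT).
  have [B2 B20 HB2] := csupp_bounded (csupp_Imc csT).
  exists (B1 + B2), C; split; [exact: addr_ge0|exact: cC|] => phi M cphi M0 HM.
  apply: (iota_bisection_bound bU).
  + exact: csuppMl.
  + by rewrite mulr_ge0 // addr_ge0.
  + move=> h; have [Ch|nCh] := pselect (C h); last first.
      by rewrite f0 // mulr0 nrm_rc normr0 mulr_ge0 // addr_ge0.
    rewrite nrmM mulrC; apply: ler_pM; rewrite ?nrm_ge0 //; last exact: HM.
    by apply: (le_trans (nrm_le _)); apply: lerD.
Qed.

End bounds.

(** * KMS states *)

Lemma csupp_div (R : realType) (Y : topologicalType) (U : set Y) (psi f : Y -> Cx R) :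
  hausdorff_space Y -> open U -> continuous psi -> (forall t, U t -> psi t != 0) ->
  csupp U f -> csupp U (fun t => (psi t)^-1 * f t).
Proof.
move=> hY oU cpsi psi0 [cf [C [cC CU f0]]].
apply: (csupp_open hY oU (fun t Ut => Ut)).
  by exists C; split; [exact: cC|exact: CU|move=> t /f0 ->; rewrite mulr0].
move=> t Ut.
have c1 : (fun t => (psi t)^-1) @ t --> (psi t)^-1.
  by apply: (@cvgV _ _ (nbhs t) (nbhs_filter t) psi (psi t)); [exact: psi0|exact: cpsi].
exact: (@cvgM _ _ (nbhs t) (nbhs_filter t) (fun t => (psi t)^-1) f _ _ c1 (cf t)).
Qed.

Section total_one.
Context d (T : measurableType d) (R : realType) (mu : {measure set T -> \bar R}).
Hypothesis mu1 : mu setT = 1%E.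

(** The proof of total mass 1 is a parameter so that the probability structure can be inferred
    from the term. *)
Definition probability_of : set T -> \bar R := let _ := mu1 in mu.

HB.instance Definition _ := Measure.copy probability_of mu.
HB.instance Definition _ := Measure_isProbability.Build _ _ _ probability_of mu1.

End total_one.

Section kms.
Context (R : realType) (G : topGroupoid).
Hypothesis G_lc : locally_compact [set: G].
Hypothesis G_hd : hausdorff_space G.
Hypothesis G_etale : etale G.
Variables (c : G -> R) (A : cstarAlg R) (iota : (G -> Cx R) -> A) (alpha : R -> A -> A).
Hypothesis c_cocycle : cocycle c.
Hypothesis A_full : full_groupoid_algebra iota.
Hypothesis alpha_c : action_of_cocycle iota c alpha.
Local Notation X := (unit_space G).
Implicit Types (g h k : G) (f : G -> Cx R) (u v : X -> Cx R).

Let X_lc : locally_compact [set: X] := unit_space_locally_compact G_lc G_hd.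
Let X_hd : hausdorff_space X := unit_space_hausdorff G_hd.
Let toCc f : csupp setT f -> Cc f := (Cc_csupp G_hd f).2.
Let iD := iotaD G_hd A_full.
Let iZ := iotaZ G_hd A_full.
Let iM := iotaM G_hd A_full.
Let iV := iotaV G_hd A_full.
Let ecs u : csupp setT u -> csupp setT (unit_ext u) := fun H => unit_ext_csupp G_hd G_etale H.

Lemma cocycle_un x : c (un x) = 0.
Proof.
have [_ cM] := c_cocycle; have := cM (un x) (un x); rewrite src_un rng_un => /(_ erefl).
have -> : mul (un x) (un x) = un x by rewrite -{1}(rng_un x) mul_un_l.
by move=> /eqP; rewrite -subr_eq subrr => /eqP.
Qed.

Lemma iotaB f f' : csupp setT f -> csupp setT f' ->
  iota (fun g => f g - f' g) = iota f - iota f'.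
Proof.
move=> cf cf'; rewrite (_ : (fun g => _) = (fun g => f g + (-1) * f' g)); last first.
  by apply/funext => g; rewrite mulN1r.
by rewrite iD ?iZ ?scaleN1r //; exact: csuppZ.
Qed.

Lemma expizc_continuous (z : Cx R) : continuous (fun g => expiz z (c g)).
Proof. by have [cc _] := c_cocycle; exact: (cont_comp cc (@expiz_continuous R z)). Qed.

(** The function z |-> exp (i z c) f extends t |-> alpha_t (f), and its derivative is
    i c exp (i z c) f: the difference quotient at h minus this derivative is the product of
    exp (i z c) f and of (exp (i h c) - 1 - i h c) / h, which tends to 0 uniformly on compact sets.
    [iota_mult_bound] turns this into convergence in norm. *)
Lemma iota_entire f : csupp setT f ->
  entire_extension alpha (iota f) (fun z => iota (fun g => expiz z (c g) * f g)).
Proof.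
move=> csf; split=> [t|z].
  rewrite alpha_c.2; last exact: toCc.
  by congr iota; apply/funext => g; rewrite expiz_real.
pose f' g := expiz z (c g) * f g.
have csf' : csupp setT f' := csuppMl (@expizc_continuous z) csf.
have [B [L [B0 cL HB]]] := iota_mult_bound G_lc G_hd G_etale A_full csf'.
have [cc _] := c_cocycle.
have [S S0 HS] := compact_bound cL cc.
pose d g := ic R * rc (c g).
have cd : continuous d by apply: contZ; exact: (cont_comp cc (@rc_continuous R)).
have csd : csupp setT (fun g => d g * f' g) := csuppMl cd csf'.
apply/cvg_ex; exists (iota (fun g => d g * f' g)).
apply/cvgrPdist_lt => eps eps0.
have e0 : 0 < Rec eps by rewrite -(@lt_rc R) -(ge0_rc (ltW eps0)).
pose K := 10 * B * S ^+ 2 + 1.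
have K0 : 0 < K by rewrite ltr_wpDl // !mulr_ge0 // sqr_ge0.
pose delta := Num.min (2^-1 / (S + 1)) (Rec eps / K).
have S1 : 0 < S + 1 by rewrite ltr_wpDl.
have delta0 : 0 < delta by rewrite lt_min !divr_gt0 // invr_gt0.
have dl1 : delta * S <= 2^-1.
  have : delta <= 2^-1 / (S + 1) by rewrite ge_min lexx.
  rewrite ler_pdivlMr // mulrDr mulr1; lra.
have dl2 : delta * K <= Rec eps by rewrite -ler_pdivlMr // ge_min lexx orbT.
have rd0 : (0 : Cx R) < rc delta by rewrite rc_gt0.
have FF : Filter ((0 : Cx R)^') := dnbhs_filter _.
have near0 := @filterI _ _ FF _ _ (@dnbhs0_lt (Cx R) (Cx R) (rc delta) rd0) (@nbhs_dnbhs_neq (Cx R) 0).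
refine (@filterS _ _ FF _ _ _ near0) => h [hd h0].
rewrite rc_nrm lt_rc in hd.
pose phi g := expiz h (c g) - 1 - ic R * h * rc (c g).
have cphi : continuous phi.
  apply: contB; last by apply: contZ; exact: (cont_comp cc (@rc_continuous R)).
  by apply: contB; [exact: expizc_continuous|exact: contC].
have csphi : csupp setT (fun g => phi g * f' g) := csuppMl cphi csf'.
have csz w : csupp setT (fun g => expiz w (c g) * f g) := csuppMl (@expizc_continuous w) csf.
have E : iota (fun g => expiz (h + z) (c g) * f g) - iota f' - h *: iota (fun g => d g * f' g) =
    iota (fun g => phi g * f' g).
  rewrite -(iZ h csd) -(iotaB (csz (h + z)) csf') -iotaB; [|exact: (csuppB (csz (h + z)) csf')|exact: (csuppZ h csd)].
  by congr iota; apply/funext => g; rewrite /phi /d /f' expizD; ring.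
have n0 : 0 < nrm h by rewrite lt_neqAle nrm_ge0 andbT eq_sym; apply: contra_neq h0 => /nrm_eq0.
have bnd : rnorm (iota (fun g => phi g * f' g)) <= B * (10 * (nrm h * S) ^+ 2).
  apply: HB => //; first by rewrite mulr_ge0 ?sqr_ge0.
  move=> g Lg; have hc : nrm h * `|c g| <= nrm h * S by rewrite ler_wpM2l ?HS ?nrm_ge0.
  have hS : nrm h * S <= delta * S by rewrite ler_wpM2r // ltW.
  apply: (le_trans (expiz_remainder _)); first by rewrite (le_trans hc) // (le_trans hS).
  by rewrite ler_pM2l // ler_sqr ?nnegrE ?mulr_ge0 ?nrm_ge0.
rewrite /= /shift /= scaler1.
have -> : iota (fun g => d g * f' g) - h^-1 *: (iota (fun g => expiz (h + z) (c g) * f g) - iota f') =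
    - (h^-1 *: iota (fun g => phi g * f' g)).
  by rewrite -E [in RHS]scalerBr scalerA mulVf // scale1r opprB.
rewrite normrN norm_rnorm (ge0_rc (ltW eps0)) lt_rc rnormZ.
have -> : nrm h^-1 = (nrm h)^-1.
  by apply: (@rc_inj R); rewrite rcV -!rc_nrm normfV.
rewrite mulrC ltr_pdivrMr //; apply: (le_lt_trans bnd).
rewrite (_ : B * _ = (10 * B * S ^+ 2) * nrm h * nrm h); last by ring.
rewrite ltr_pM2r //.
apply: (@lt_le_trans _ _ (K * delta)); last by rewrite mulrC.
apply: (@le_lt_trans _ _ (K * nrm h)).
  by rewrite ler_wpM2r ?nrm_ge0 // lerDl.
by rewrite ltr_pM2l.
Qed.

Variables (beta : R) (omega : {scalar A}).
Hypothesis omega_kms : kms_state alpha beta omega.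
Local Notation E g := (rc (expR (- beta * c g))).

Lemma weight_continuous : continuous (fun g => E g).
Proof.
have H := @expizc_continuous (toCx 0 beta).
rewrite (_ : (fun g => E g) = (fun g => expiz (toCx 0 beta) (c g))); first exact: H.
by apply/funext => g; rewrite expiz_imag.
Qed.

Lemma kms_iota f f' : csupp setT f ->
  omega (cmul (iota f') (iota (fun g => E g * f g))) = omega (cmul (iota f) (iota f')).
Proof.
move=> csf; have [_ K _] := omega_kms; have := K _ (iota f') _ (iota_entire csf).
by rewrite (_ : (fun g => expiz _ _ * _) = (fun g => E g * f g)) //; apply/funext => g; rewrite expiz_imag.
Qed.

Lemma kms_conv f f' : csupp setT f -> csupp setT f' ->
  omega (iota (conv f' (fun g => E g * f g))) = omega (iota (conv f f')).
Proof.
move=> csf csf'; rewrite !iM //; first exact: kms_iota.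
by apply: csuppMl => //; exact: weight_continuous.
Qed.

Lemma iota0 : iota (fun=> 0) = 0.
Proof.
rewrite (_ : (fun=> 0) = (fun g : G => 0 * (0 : Cx R))); last first.
  by apply/funext => g; rewrite mulr0.
by rewrite iZ ?scale0r //; exact: csupp0.
Qed.

Lemma unit_bump (C V : set X) : compact C -> open V -> C `<=` V ->
  exists u, [/\ csupp V u, csupp setT u & forall x, C x -> u x = 1].
Proof.
move=> cC oV CV; have [e [D [W [ce e01 [cD DV e0] [_ CW e1]]]]] :=
  @lch_urysohn R X X_lc X_hd C V cC oV CV.
have cse : csupp V e by split => //; exists D.
exists (fun x => rc (e x)); split; first exact: csupp_rc.
  by apply: csupp_rc; exact: csupp_sub cse.
by move=> x /CW /e1 ->.
Qed.

(** With u a bump function equal to 1 on the ranges of the support of f and supported in V1,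
    u * f = f and f * u = 0.  As c is 0 on units, u is fixed by the dynamics, and the KMS condition
    exchanges the two products. *)
Lemma vanish_moving (V1 V2 : set X) f : open V1 -> open V2 -> V1 `&` V2 = set0 ->
  csupp ((@rng G) @^-1` V1 `&` (@src G) @^-1` V2) f -> omega (iota f) = 0.
Proof.
move=> oV1 oV2 V12 csf; have csT : csupp setT f by exact: csupp_sub csf.
have [_ [C [cC CU f0]]] := csf.
have cr : compact ((@rng G) @` C).
  by apply: compact_image => //; exact: rng_continuous.
have [|u [csu csuT u1]] := unit_bump cr oV1.
  by move=> _ [g /CU [gV _] <-].
have cse := ecs csuT.
have := kms_conv cse csT.
have -> : (fun g => E g * unit_ext u g) = unit_ext u.
  apply/funext => g; have [gu|ngu] := pselect (units g).
    by rewrite gu cocycle_un mulr0 expR0 mul1r.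
  by rewrite unit_ext_out // mulr0.
rewrite conv_unit_ext_l conv_unit_ext_r.
have -> : (fun g => u (rng g) * f g) = f.
  apply/funext => g; have [Cg|/f0 ->] := pselect (C g); last by rewrite mulr0.
  by rewrite u1 ?mul1r //; exists g.
have -> : (fun g => f g * u (src g)) = (fun=> 0).
  apply/funext => g; have [Cg|/f0 ->] := pselect (C g); last by rewrite mul0r.
  have [_ [D [_ DV u0]]] := csu.
  rewrite u0 ?mulr0 // => /DV V1g; have [_ V2g] := CU _ Cg.
  by have : (V1 `&` V2) (src g) by []; rewrite V12.
by rewrite iota0 linear0.
Qed.

(** Divide f by psi - 1, which has no zero on U, and apply the invariance to the quotient. *)
Lemma vanish_twist (psi : G -> Cx R) (U : set G) f : open U -> continuous psi ->
  (forall f', csupp setT f' -> omega (iota (fun g => psi g * f' g)) = omega (iota f')) ->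
  (forall g, U g -> psi g != 1) -> csupp U f -> omega (iota f) = 0.
Proof.
move=> oU cpsi inv_psi psi1 csf.
have cpsi1 : continuous (fun g => psi g - 1) by apply: contB; [exact: cpsi|exact: contC].
have csf' : csupp U (fun g => (psi g - 1)^-1 * f g).
  by apply: csupp_div => // g Ug; rewrite subr_eq0 psi1.
have csT : csupp setT (fun g => (psi g - 1)^-1 * f g) by exact: csupp_sub csf'.
set f' := fun g => _ in csf' csT.
have -> : f = (fun g => psi g * f' g - f' g).
  apply/funext => g; rewrite /f' -{2}[(psi g - 1)^-1 * f g]mul1r -mulrBl.
  have [Ug|nUg] := pselect (U g).
    by rewrite mulrA divff ?mul1r // subr_eq0 psi1.
  have [_ [C [_ CU f0]]] := csf.
  by rewrite f0 ?mulr0 // => /CU.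
have csp : csupp setT (fun g => psi g * f' g) := csuppMl cpsi csT.
by rewrite (iotaB csp csT) linearB /= (inv_psi _ csT) subrr.
Qed.

(** The KMS condition for f and a bump function u on units with u * f = f = f * u. *)
Lemma omega_weight_inv f : csupp setT f -> omega (iota (fun g => E g * f g)) = omega (iota f).
Proof.
move=> csf; have [_ [C [cC _ f0]]] := csf.
have cr : compact ((@rng G) @` C `|` (@src G) @` C).
  apply: compactU; apply: continuous_compact => //; apply: continuous_subspaceT.
    exact: rng_continuous.
  exact: src_continuous.
have [u [_ csuT u1]] := unit_bump cr openT (fun _ _ => I).
have := kms_conv csf (ecs csuT); rewrite conv_unit_ext_l conv_unit_ext_r.
have -> : (fun g => f g * u (src g)) = f.
  apply/funext => g; have [Cg|/f0 ->] := pselect (C g); last by rewrite mul0r.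
  by rewrite u1 ?mulr1 //; right; exists g.
have -> // : (fun g => u (rng g) * (E g * f g)) = (fun g => E g * f g).
apply/funext => g; have [Cg|/f0 ->] := pselect (C g); last by rewrite !mulr0.
by rewrite u1 ?mul1r //; left; exists g.
Qed.

Hypothesis c_principal : zero_set_principal c.

(** Near an arrow that is not a unit, either range and source are separated, which is the case
    of [vanish_moving], or c does not vanish, and f can be divided as in [vanish_twist] by
    exp (- beta c) - 1 if beta <> 0, by exp (i t c) - 1 if beta = 0. *)
Lemma vanish_off_units f : csupp (~` @units G) f -> omega (iota f) = 0.
Proof.
move: f; apply: (csupp_rect G_lc G_hd (P := fun f => omega (iota f) = 0)).
- by rewrite iota0 linear0.
- move=> f f' csf csf' Hf Hf'; rewrite iD ?linearD /= ?Hf ?Hf' ?addr0 //.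
    exact: csupp_sub csf.
  exact: csupp_sub csf'.
- move=> g ngu; have [rs|rs] := pselect (rng g = src g); last first.
    have ne : rng g != src g by apply/eqP.
    have := X_hd; rewrite open_hausdorff => /(_ _ _ ne) [[V1 V2] /= [/set_mem g1 /set_mem g2] [oV1 oV2 /eqP V12]].
    exists ((@rng G) @^-1` V1 `&` (@src G) @^-1` V2); split.
    + apply: openI; apply: open_comp => // ? _; [exact: rng_continuous|exact: src_continuous].
    + by split.
    + by move=> f csf _; exact: (vanish_moving oV1 oV2 V12 csf).
  have cg : c g != 0.
    by apply/eqP => /(c_principal rs) [x gx]; apply: ngu; rewrite gx; exact: units_un.
  have [cc _] := c_cocycle.
  have [b0|b0] := eqVneq beta 0; last first.
    exists [set h | c h != 0]; split.
    + by apply: (@open_comp G R c [set t | t != 0]) => [? _|]; [exact: cc|exact: open_neq].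
    + exact: cg.
    + move=> f csf _; apply: (vanish_twist _ weight_continuous omega_weight_inv _ csf).
        by apply: (@open_comp G R c [set t | t != 0]) => [? _|]; [exact: cc|exact: open_neq].
      move=> h /= ch; apply: contra_neq ch => /(@rc_inj R) /eqP.
      rewrite -expR0 (inj_eq (@expR_inj R)) mulf_eq0 oppr_eq0 (negPf b0) /=.
      by move=> /eqP.
  have [_ _ inv_t] := omega_kms; have {}inv_t := inv_t b0.
  (* With this t one has |t c| = 1/2 at g, so 0 < |t c| < 1 near g, where exp (i t c) <> 1. *)
  pose t := (2 * `|c g|)^-1.
  have t0 : 0 < t by rewrite invr_gt0 mulr_gt0 // normr_gt0.
  have oU : open [set h | 0 < `|t * c h| < 1].
    have -> : [set h | 0 < `|t * c h| < 1] = (fun h => `|t * c h|) @^-1` (`]0, 1[%classic).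
      by apply/seteqP; split => h; rewrite /= in_itv.
    apply: open_comp => [? _|]; last exact: interval_open.
    have ct : continuous (fun h => t * c h) by apply: contZ.
    exact: (cont_comp ct (@norm_continuous _ R^o)).
  exists [set h | 0 < `|t * c h| < 1]; split; first exact: oU.
    have tc : `|t * c g| = 2^-1.
      by rewrite normrM gtr0_norm // /t invfM -mulrA mulVf ?mulr1 // normr_eq0.
    by rewrite /= tc; lra.
  move=> f csf _; apply: (vanish_twist (psi := fun h => expi (t * c h)) oU _ _ _ csf).
  + have ct : continuous (fun h => t * c h) by apply: contZ.
    exact: (cont_comp ct (@expi_continuous R)).
  + move=> f' csf'; rewrite -[RHS](inv_t t) alpha_c.2 //; exact: toCc.
  + by move=> h /= /andP[h0 h1]; apply: expi_neq1; rewrite h0 ltW.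
Qed.

Definition unit_functional u : Cx R := omega (iota (unit_ext u)).

Lemma csupp_comp_un f : csupp setT f -> csupp setT (fun x => f (un x)).
Proof.
move=> [cf [C [cC _ f0]]]; split; first exact: (cont_comp (@un_continuous G) cf).
exists ((@rng G) @` (C `&` @units G)); split => //.
  apply: continuous_compact; first by apply: continuous_subspaceT; exact: rng_continuous.
  by apply: compact_closedI => //; exact: units_closed.
move=> x nC; apply: f0 => Cx; apply: nC; exists (un x); last exact: rng_un.
by split => //; exact: units_un.
Qed.

Lemma omega_units f : csupp setT f -> omega (iota f) = unit_functional (fun x => f (un x)).
Proof.
move=> csf; have cse := ecs (csupp_comp_un csf).
have cs1 := csuppB csf cse.
have : omega (iota (fun g => f g - unit_ext (fun x => f (un x)) g)) = 0.
  apply: vanish_off_units; split; first exact: cs1.1.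
  have [_ [C [cC _ f0]]] := csf.
  exists (C `&` ~` @units G); split.
  - by apply: compact_closedI => //; apply: open_closedC; exact: units_open.
  - by move=> g [].
  - move=> g nC; have [gu|ngu] := pselect (units g).
      by rewrite unit_ext_in // -gu subrr.
    rewrite unit_ext_out // subr0; apply: f0 => Cg; apply: nC; split => //.
by rewrite iotaB // linearB => /eqP; rewrite subr_eq0 => /eqP.
Qed.

Lemma unit_functionalD u v : csupp setT u -> csupp setT v ->
  unit_functional (fun x => u x + v x) = unit_functional u + unit_functional v.
Proof. by move=> cu cv; rewrite /unit_functional unit_extD iD ?linearD //; exact: ecs. Qed.

Lemma unit_functionalZ (k : Cx R) u : csupp setT u ->
  unit_functional (fun x => k * u x) = k * unit_functional u.
Proof. by move=> cu; rewrite /unit_functional unit_extZ iZ ?linearZ //; exact: ecs. Qed.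

Lemma unit_functional_ge0 u : csupp setT u -> (forall x, 0 <= u x) -> 0 <= unit_functional u.
Proof.
move=> csu u0; have [[pos _ _] _ _] := omega_kms.
pose r x := rc (Num.sqrt (Rec (u x) - nrm (0 : Cx R) ^+ 2)).
have n0 : nrm (0 : Cx R) = 0 by rewrite nrm_rc normr0.
have csr : csupp setT r.
  apply: (csupp_sqrt (@csupp0 _ _ _) (csupp_Rec csu)) => x.
  by rewrite n0 expr0n; exact: ge0_Rec.
have -> : u = (fun x => Num.conj (r x) * r x).
  apply/funext => x; rewrite conjM_nrm nrm_rc n0 expr0n subr0.
  by rewrite ger0_norm ?sqrtr_ge0 // sqr_sqrtr ?ge0_Rec // -ge0_rc.
have cse := ecs csr.
rewrite /unit_functional -conv_unit_ext -invol_unit_ext iM ?iV //; last exact: csupp_invol.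
Qed.

(** For f supported in a bisection, let k be a bump function supported there and equal to 1 on
    the support of f.  Then f * k^* and k^* * (exp (- beta c) f) are the two fibre sums, and the KMS
    condition equates the values of omega on them. *)
Lemma unit_functional_quasi_invariant f : csupp setT f ->
  unit_functional (fiber_sum (@rng G) f) = unit_functional (fiber_sum (@src G) (fun g => E g * f g)).
Proof.
have rl := G_etale; have sl := src_local_homeomorphism G_etale.
move: f; apply: (csupp_rect G_lc G_hd).
- rewrite fiber_sum0 (_ : (fun g => _) = (fun=> 0)) ?fiber_sum0 //.
  by apply/funext => g; rewrite mulr0.
- move=> f f' csf csf' Hf Hf'.
  have csE (v : G -> Cx R) : csupp setT v -> csupp setT (fun g : G => E g * v g).
    by move=> csv; apply: csuppMl => //; exact: weight_continuous.
  rewrite (fiber_sumD G_lc G_hd rl csf csf') unit_functionalD; [|exact: fiber_sum_csupp|exact: fiber_sum_csupp].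
  rewrite (_ : (fun g => E g * _) = (fun g => E g * f g + E g * f' g)); last first.
    by apply/funext => g; rewrite mulrDr.
  rewrite (fiber_sumD G_lc G_hd sl (csE _ csf) (csE _ csf')) unit_functionalD ?Hf ?Hf' //.
    by apply: fiber_sum_csupp => //; exact: csE.
  by apply: fiber_sum_csupp => //; exact: csE.
- move=> g _; have [U [bU Ug]] := bisection_nbhs G_etale g.
  have [oU rU sU] := bU.
  exists U; split; [exact: oU|exact: Ug|] => f csf csT.
  have [_ [C [cC CU f0]]] := csf.
  have [e [D [W [ce e01 [cD DU e0] [_ CW e1]]]]] :=
    @lch_urysohn R G G_lc G_hd C U cC oU CU.
  have cse : csupp U (fun g => rc (e g)) by apply: csupp_rc; split => //; exists D.
  have cseT : csupp setT (fun g => rc (e g)) by exact: csupp_sub cse.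
  have f0U h : ~ U h -> f h = 0 by move=> nUh; apply: f0 => /CU.
  have e0U h : ~ U h -> rc (e h) = 0 by move=> nUh; rewrite e0 // => /DU.
  have := kms_conv csT (csupp_invol cseT).
  rewrite (conv_invol_r sU f0U e0U) (conv_invol_l rU e0U); last first.
    by move=> h /f0U ->; rewrite mulr0.
  have c1 h : C h -> Num.conj (rc (e h)) = 1.
    by move=> /CW /e1 ->; rewrite rmorph1.
  rewrite (_ : (fun h => Num.conj _ * _) = (fun h => E h * f h)); last first.
    apply/funext => h; have [Ch|/f0 ->] := pselect (C h); last by rewrite !mulr0.
    by rewrite c1 // mul1r.
  rewrite (_ : (fun h => f h * _) = f); last first.
    apply/funext => h; have [Ch|/f0 ->] := pselect (C h); last by rewrite mul0r.
    by rewrite c1 // mulr1.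
  by move=> H; rewrite /unit_functional H.
Qed.

(** Positivity of omega at y - w x^*, where w = omega (x y).  Positivity at k x^* + y for
    k = 1 and k = i shows that the value of omega at y^* x^* is conj w.  This polynomial form needs no
    division. *)
Lemma state_cauchy_schwarz (x y : A) :
  0 <= Rec (omega (cmul (cstar y) y)) - 2 * nrm (omega (cmul x y)) ^+ 2 +
    nrm (omega (cmul x y)) ^+ 2 * Rec (omega (cmul x (cstar x))).
Proof.
set w := omega (cmul x y).
have [[pos _ _] _ _] := omega_kms.
pose P := omega (cmul (cstar y) y); pose Q := omega (cmul x (cstar x)).
pose a := omega (cmul (cstar y) (cstar x)).
have exp (k : Cx R) : 0 <= Num.conj k * (k * Q + w) + (k * a + P).
  have := pos (k *: cstar x + y).
  rewrite cstar_antilinear cstarK cmul_linear_l !cmul_linear_r.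
  by rewrite linearD linearZ /= !linearD /= !linearZ.
have P0 : Imc P = 0 by apply: ge0_Imc; exact: pos.
have Q0 : Imc Q = 0 by apply: ge0_Imc; have := pos (cstar x); rewrite cstarK.
(* The imaginary parts for k = 1 and k = i identify a with the conjugate of w. *)
have e1 := ge0_Imc (exp 1); have e2 := ge0_Imc (exp (ic R)).
have e3 := ge0_Rec (exp (- w)).
move: e1 e2 e3; rewrite -/w -/P -/Q /ic !CxE P0 Q0 nrm_sq => e1 e2 e3.
have aI : Imc a = - Imc w by lra.
have aR : Rec a = Rec w by lra.
move: e3; rewrite aI aR; lra.
Qed.

Lemma unit_functional_le1 (f : X -> R) : subordinate setT f -> re_functional unit_functional f <= 1.
Proof.
move=> [csf f01]; have [[_ bnd _] _ _] := omega_kms.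
have csr := csupp_rc csf.
apply: le_trans (ler_norm _) _; apply: le_trans (nrm_Rec _) _.
apply: (@le_trans _ _ (rnorm (iota (unit_ext (fun t => rc (f t)))))).
  by rewrite -(@le_rc R) -rc_nrm -norm_rnorm; exact: bnd.
apply: (iota_unit_ext_bound G_lc G_hd G_etale A_full csr ler01) => t.
by have /andP[f0 f1] := f01 t; rewrite nrm_rc ger0_norm.
Qed.

Lemma omega_rnorm (a : A) : nrm (omega a) <= rnorm a.
Proof.
have [[_ bnd _] _ _] := omega_kms.
by rewrite -(@le_rc R) -rc_nrm -norm_rnorm; exact: bnd.
Qed.

(** Pick f in C_c(G) of norm about 1 with |omega f| about 1, and a bump function u on units with
    u * f = f.  By Cauchy-Schwarz, the value of omega at u u^* is about 1 as well. *)
Lemma mass_lower (d : R) : 0 < d < 1 ->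
  exists f : X -> R, subordinate setT f /\ 1 - d <= re_functional unit_functional f.
Proof.
(* The final estimate is (1 - 2 e)^2 (1 + 20 e) > (1 + e)^2 for 0 < e < 1/20. *)
move=> /andP[d0 d1]; pose e := d / 20.
have e0 : 0 < e by rewrite divr_gt0.
have [[pos bnd one] _ _] := omega_kms.
have re0 : (0 : Cx R) < rc e by rewrite rc_gt0.
have [a [a1 ae]] := one _ re0.
have : closure (iota @` [set f | Cc f]) a by rewrite (iota_dense A_full).
move=> /(_ (ball a (rc e)) (nbhsx_ballx _ _ re0)) [_ [[f cf <-] af]].
have csf : csupp setT f by exact/(Cc_csupp G_hd).
have {}af : rnorm (a - iota f) < e.
  by rewrite -(@lt_rc R) -norm_rnorm; move: af; rewrite -ball_normE.
have {}a1 : rnorm a <= 1 by rewrite -rnorm_leP rc1.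
have {}ae : 1 - e < nrm (omega a).
  by rewrite -(@lt_rc R) -rc_nrm rcB rc1.
have [_ [C [cC _ f0]]] := csf.
have cr : compact ((@rng G) @` C).
  by apply: compact_image => //; exact: rng_continuous.
have [phi [D [W [cphi phi01 [cD _ phi0] [_ CW phi1]]]]] :=
  @lch_urysohn R X X_lc X_hd _ setT cr openT (fun _ _ => I).
have csphi : csupp setT phi by split => //; exists D.
have csu := csupp_rc csphi; pose u x := rc (phi x).
have uf : iota f = cmul (iota (unit_ext u)) (iota f).
  rewrite -iM //; last exact: ecs.
  rewrite conv_unit_ext_l; congr iota; apply/funext => g.
  have [Cg|/f0 ->] := pselect (C g); last by rewrite mulr0.
  by rewrite /u phi1 ?mul1r //; apply: CW; exists g.
exists (fun x => phi x * phi x); split.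
  split; first exact: csuppMl.
  by move=> x; have /andP[p0 p1] := phi01 x; rewrite mulr_ge0 // mulr_ile1.
have := state_cauchy_schwarz (iota (unit_ext u)) (iota f); rewrite -uf.
set w := omega (iota f).
have wlow : 1 - 2 * e < nrm w.
  have : nrm (omega a) <= nrm (omega (a - iota f)) + nrm w.
    by rewrite -[in leLHS](subrK (iota f) a) linearD; exact: nrmD.
  have := omega_rnorm (a - iota f); lra.
have fle : rnorm (iota f) <= 1 + e.
  have : rnorm (iota f) <= rnorm (iota f - a) + rnorm a.
    by rewrite -[in leLHS](subrK a (iota f)) rnormD.
  rewrite (_ : rnorm (iota f - a) = rnorm (a - iota f)); first lra.
  by rewrite /rnorm distrC.
have Ple : Rec (omega (cmul (cstar (iota f)) (iota f))) <= (1 + e) ^+ 2.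
  apply: le_trans (ler_norm _) _; apply: le_trans (nrm_Rec _) _.
  apply: (le_trans (omega_rnorm _)).
  have -> : rnorm (cmul (cstar (iota f)) (iota f)) = rnorm (iota f) ^+ 2.
    by apply: (@rc_inj R); rewrite -norm_rnorm cstar_identity norm_rnorm rcX.
  by rewrite ler_sqr ?nnegrE ?rnorm_ge0 // addr_ge0 // ltW.
have -> : Rec (omega (cmul (iota (unit_ext u)) (cstar (iota (unit_ext u))))) =
    re_functional unit_functional (fun x => phi x * phi x).
  rewrite -iV; last exact: ecs.
  rewrite -iM; [|exact: ecs|by apply: csupp_invol; exact: ecs].
  rewrite invol_unit_ext conv_unit_ext /re_functional /unit_functional; congr (Rec (omega (iota (unit_ext _)))).
  by apply/funext => x; apply: Cx_eqP; rewrite /u !CxE; ring.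
set q := re_functional _ _; move: Ple; set P := Rec _ => Ple H.
have dE : d = 20 * e by rewrite /e; field.
have e05 : e < 1 / 20 by lra.
have w0 : 0 < 1 - 2 * e by lra.
have w2 : (1 - 2 * e) ^+ 2 <= nrm w ^+ 2 by rewrite ler_sqr ?nnegrE ?nrm_ge0 ?ltW.
rewrite leNgt; apply/negP => qd.
have w2p : 0 < nrm w ^+ 2 by apply: lt_le_trans w2; rewrite exprn_gt0.
have H1 : nrm w ^+ 2 * q <= nrm w ^+ 2 * (1 - d) by rewrite ler_wpM2l // ltW.
have H2 : (1 - 2 * e) ^+ 2 * (1 + d) <= nrm w ^+ 2 * (1 + d) by rewrite ler_wpM2r //; lra.
have H3 : nrm w ^+ 2 * (1 + d) <= (1 + e) ^+ 2 by move: H H1 Ple; lra.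
have : (1 - 2 * e) ^+ 2 * (1 + d) <= (1 + e) ^+ 2 by exact: le_trans H3.
rewrite dE => H4.
have : 14 * e - 77 * e ^+ 2 + 80 * e ^+ 3 <= 0.
  have -> : 14 * e - 77 * e ^+ 2 + 80 * e ^+ 3 = (1 - 2 * e) ^+ 2 * (1 + 20 * e) - (1 + e) ^+ 2 by ring.
  by rewrite subr_le0.
have -> : 14 * e - 77 * e ^+ 2 + 80 * e ^+ 3 = e * (14 - 77 * e + 80 * e ^+ 2) by ring.
rewrite pmulr_rle0 //; have := sqr_ge0 e; lra.
Qed.

Lemma total_mass : open_mass (re_functional unit_functional) setT = 1%E.
Proof.
apply/eqP; rewrite eq_le; apply/andP; split.
  by apply: ge_ereal_sup => _ [f pf <-]; rewrite lee_fin; exact: unit_functional_le1.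
apply/lee_addgt0Pr => d d0.
pose d' := Num.min d 2^-1.
have d'01 : 0 < d' < 1 by rewrite lt_min d0 invr_gt0 ltr0n gt_min orbC invf_lt1 ?ltr1n.
have [f [pf fd]] := mass_lower d'01.
apply: (@le_trans _ _ ((re_functional unit_functional f)%:E + d%:E)%E).
  rewrite -EFinD lee_fin; have : d' <= d by rewrite ge_min lexx.
  lra.
by rewrite leeD2r // subordinate_open_mass.
Qed.

Lemma kms_measure : exists mu : probability (borel X) R,
  [/\ radon_measure mu, quasi_invariant mu,
      rn_derivative mu (fun g => expR (- beta * c g)) & is_omega iota mu omega].
Proof.
have rl := G_etale; have sl := src_local_homeomorphism G_etale.
have [mu [rmu muT muU]] := riesz_complex X_lc X_hd unit_functionalD unit_functionalZ unit_functional_ge0.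
have mu1 : mu setT = 1%E by rewrite muU ?total_mass //; exact: openT.
pose P : probability (borel X) R := probability_of mu1.
have fiber_functional (p : G -> X) : local_homeomorphism p ->
    [/\ (forall f f', csupp setT f -> csupp setT f' ->
          unit_functional (fiber_sum p (fun t => f t + f' t)) = unit_functional (fiber_sum p f) + unit_functional (fiber_sum p f')),
        (forall (k : Cx R) f, csupp setT f ->
          unit_functional (fiber_sum p (fun t => k * f t)) = k * unit_functional (fiber_sum p f)) &
        (forall f, csupp setT f -> (forall t, 0 <= f t) -> 0 <= unit_functional (fiber_sum p f))].
  move=> plh; have pc f : csupp setT f -> csupp setT (fiber_sum p f).
    by move=> csf; exact: fiber_sum_csupp.
  split.
  - by move=> f f' csf csf'; rewrite (fiber_sumD G_lc G_hd plh csf csf') unit_functionalD //; exact: pc.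
  - by move=> k f csf; rewrite fiber_sumZ unit_functionalZ //; exact: pc.
  - move=> f csf f0; apply: unit_functional_ge0; first exact: pc.
    by move=> y; exact: fiber_sum_ge0.
have [rD rZ r0] := fiber_functional _ rl; have [sD sZ s0] := fiber_functional _ sl.
have [nur [rnur nurT nurU]] := riesz_complex G_lc G_hd rD rZ r0.
have [nus [rnus nusT nusU]] := riesz_complex G_lc G_hd sD sZ s0.
have pbr : pullback_measure (@rng G) P nur.
  split => // f /(Cc_csupp G_hd) csf; rewrite nurT //; symmetry.
  by apply: muT; exact: fiber_sum_csupp.
have pbs : pullback_measure (@src G) P nus.
  split => // f /(Cc_csupp G_hd) csf; rewrite nusT //; symmetry.
  by apply: muT; exact: fiber_sum_csupp.
have [cc _] := c_cocycle.
pose h g : R := expR (- beta * c g).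
have ch : continuous h.
  apply: (@cont_comp _ _ _ (fun g => - beta * c g) expR); last exact: continuous_expR.
  exact: contZ.
have h0 g : 0 < h g by exact: expR_gt0.
have hML (f : G -> R) : csupp setT f ->
    re_functional (fun f => unit_functional (fiber_sum (@rng G) f)) f =
    re_functional (fun f => unit_functional (fiber_sum (@src G) f)) (fun t => h t * f t).
  move=> csf; rewrite /re_functional (unit_functional_quasi_invariant (csupp_rc csf)); congr (Rec (unit_functional (fiber_sum _ _))).
  by apply/funext => t; rewrite rcM.
have [_ our _] := rnur; have [_ ous _] := rnus.
have open_bounds (U : set G) (a b : R) : open U -> 0 < a -> 0 < b ->
    (forall t, U t -> a <= h t <= b) -> (a%:E * nus U <= nur U <= b%:E * nus U)%E.
  move=> oU a0 b0 hab; rewrite nurU // nusU //.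
  by apply: (open_mass_density (re_functionalD sD) (re_functionalZ sZ) (re_functional_ge0 s0) ch hML).
exists P; split => //.
- have [ac1 ac2] := density_equivalent ch h0 our ous open_bounds.
  by exists nur, nus; split.
- exists nur, nus; split => // E mE; exact: (density_eq ch h0 our ous open_bounds).
- have [st _ _] := omega_kms; split => // f /(Cc_csupp G_hd) csf.
  by rewrite omega_units // -muT //; exact: csupp_comp_un.
Qed.

End kms.

(** * KMS states come from quasi-invariant measures *)

Theorem proposition3p2 (R : realType) (G : topGroupoid)
  (G_locally_compact : locally_compact [set: G])
  (G_hausdorff : hausdorff_space G)
  (G_etale : etale G)
  (c : G -> R) (c_cocycle : cocycle c)
  (A : cstarAlg R) (iota : (G -> Cx R) -> A)
  (A_full : full_groupoid_algebra iota)
  (alpha : R -> A -> A) (alpha_c : action_of_cocycle iota c alpha)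
  (c_principal : zero_set_principal c)
  (beta : R) (omega : {scalar A}) (omega_kms : kms_state alpha beta omega) :
  exists mu : probability (borel (unit_space G)) R,
    [/\ radon_measure mu,
        quasi_invariant mu,
        rn_derivative mu (fun g => expR (- beta * c g)) &
        is_omega iota mu omega].
Proof.
exact: (kms_measure G_locally_compact G_hausdorff G_etale c_cocycle A_full alpha_c omega_kms c_principal).
Qed.
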